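(* Let $\mathcal P=\{P_{\theta,G}:\theta\in\Theta,\ G\in\mathcal G\}$ be a semiparametric model, $\Theta\subset\mathbb R^k$ open, $\mathcal G$ a subset of a Hilbert space $\mathcal H$, and let $\nu(P_{\theta,G})=\tilde\nu(G)$ with $\tilde\nu:\mathcal G\to\mathcal B$, $\mathcal B$ a Banach space. Fix $\theta_0\in\Theta$, $G\in\mathcal G$ and $\mathcal B_0^*\subset\mathcal B^*$. Suppose that for an appropriately chosen collection $\mathcal C_G$ of paths in $\mathcal G$ through $G$ (all notions as defined in the context): (1) $\mathcal P_1(G)=\{P_{\theta,G}:\theta\in\Theta\}$ is a regular parametric model and $\mathcal P$ is Hellinger differentiable at $P_{\theta,G}$, $\theta\in\Theta$; $\dot{\mathcal G}^0$ is a closed linear subspace of $\mathcal H$, i.e. $\dot{\mathcal G}=\dot{\mathcal G}^0$; $\tilde\nu$ is pathwise differentiable at $G$; the efficient information matrix $I_*(\theta)$ is nonsingular; (2) $\dot{\tilde\nu}_{b^*}\in R(\dot l_2^\top(\theta,G)\dot l_2(\theta,G))$ for all $b^*\in\mathcal B^*$ (at $P_{\theta,G}$, $\theta\in\Theta$); (3) for every $h\in\dot{\mathcal G}$ and every sequence $\{\theta_n\}\subset\Theta$ with $\{\sqrt n(\theta_n-\theta_0)\}$ bounded, $$\Bigl|\frac1{\sqrt n}\sum_{i=1}^n\psi_h(X_i;\theta_n,G)-\frac1{\sqrt n}\sum_{i=1}^n\psi_h(X_i;\theta_0,G)-c_h(\theta_0)\sqrt n(\theta_n-\theta_0)\Bigr|\to0$$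 in $P_{\theta_0,G}$-probability, and $c_h(\theta_n)\to c_h(\theta_0)$; (4) the submodel estimator $\hat\nu_{\theta,n}=u_n(X_1,\dots,X_n;\theta)$ is $\mathcal B_0^*$-weakly locally submodel efficient at $P_{\theta_0,G}$: for every sequence $\{\theta_n\}\subset\Theta$ with $\{\sqrt n(\theta_n-\theta_0)\}$ bounded and every $b^*\in\mathcal B_0^*$, $$\sqrt n\Bigl|b^*(\hat\nu_{\theta_n,n}-\tilde\nu(G))-\frac1n\sum_{i=1}^n\psi(X_i;\theta_n,G;b^* )\Bigr|\to0\ \text{ in }P_{\theta_0,G}\text{-probability};$$ (5) $\hat\theta_n=t_n(X_1,\dots,X_n)$ is an efficient estimator of $\theta$ in $\mathcal P$. Let $\{\lambda_n\}$ be integers with $\lambda_n/n\to\frac12$, put $\tilde\theta_{n1}=t_{\lambda_n}(X_1,\dots,X_{\lambda_n})$, $\tilde\theta_{n2}=t_{n-\lambda_n}(X_{\lambda_n+1},\dots,X_n)$ and $$\hat\nu_n=\frac{\lambda_n}n\,u_{\lambda_n}(X_1,\dots,X_{\lambda_n};\tilde\theta_{n2})+\frac{n-\lambda_n}n\,u_{n-\lambda_n}(X_{\lambda_n+1},\dots,X_n;\tilde\theta_{n1}).$$ Then $\hat\nu_n$ is a $\mathcal B_0^*$-weakly efficient estimator of $\nu$ within the full model $\mathcal P$ at $P_{\theta_0,G}$; that is, for every sequence $\{\theta_n\}\subset\Theta$ with $\{\sqrt n(\theta_n-\theta_0)\}$ bounded and every $b^*\in\mathcal B_0^*$, $$\sqrt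 n\Bigl|b^*(\hat\nu_n-\nu(P_{\theta_n,G}))-\frac1n\sum_{i=1}^n\bigl[\psi(X_i;\theta_n,G;b^* )+c(\theta_n,G;b^* )I_*^{-1}(\theta_n)l_1^*(\theta_n)(X_i)\bigr]\Bigr|\to0$$ in $P_{\theta_0,G}$-probability.
   Context: $X_1,X_2,\dots$ are i.i.d. with distribution $P_{\theta,G}$ on $(\mathcal X,\mathcal A)$; $s(\theta,G)$ is the square root of the density of $P_{\theta,G}$ with respect to a $\sigma$-finite dominating measure $\mu$ (of the submodel or path considered). $L_2^0(P)=\{f\in L_2(P):\int f\,dP=0\}$. $\mathcal B^*$ is the dual of $\mathcal B$, $R(A)$ the range of an operator $A$, $A^\top$ its adjoint. Statistics are measurable; measurable versions of the $L_2$-functions below (jointly in $(x,\theta)$) are fixed. Regular parametric model: $\{P_\theta:\theta\in\Theta\}$ with root densities $s(\theta)$ w.r.t. a $\sigma$-finite $\mu$ is regular if (i) for all $\theta$ there is a $k$-vector $\dot l(\theta)$ of functions in $L_2(P_\theta)$ with $s(\tilde\theta)=s(\theta)+\frac12(\tilde\theta-\theta)^\top\dot l(\theta)s(\theta)+o(|\tilde\theta-\theta|)$ in $L_2(\mu)$; (ii) $\int\dot l\dot l^\top(\theta)\,dP_\theta$ is nonsingular for all $\theta$; (iii) $\theta\mapsto\dot l(\theta)s(\theta)$ is continuous into $L_2^k(\mu)$. The score vector of $\mathcal P_1(G)$ is denoted $\dot l_1(\theta)=\dot l_1(\theta,G)$. Paths: a path in $\mathcal G$ through $G$ is a set $\{G_\eta:|\eta|<1\}\subset\mathcal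 G$ with $G_0=G$ and $\eta\mapsto G_\eta\in\mathcal H$ continuously Fréchet differentiable with nonvanishing derivative; its tangent is $\dot G\in\mathcal H$ with $G_\eta=G+\eta\dot G+o(\eta)$. $\dot{\mathcal G}^0$ is the set of tangents of paths in $\mathcal C_G$ (with $0$ adjoined), $\dot{\mathcal G}$ its closed linear span in $\mathcal H$. Pathwise differentiability of $\tilde\nu$ at $G$: there is a bounded linear $\dot{\tilde\nu}:\dot{\mathcal G}\to\mathcal B$ with $\|\tilde\nu(G_\eta)-\tilde\nu(G)-\eta\dot{\tilde\nu}(\dot G)\|_{\mathcal B}=o(\eta)$ for all paths in $\mathcal C_G$. For $b^*\in\mathcal B^*$ the gradient $\dot{\tilde\nu}_{b^*}\in\dot{\mathcal G}$ is the unique element with $b^*(\dot{\tilde\nu}(\dot G))=\langle\dot{\tilde\nu}_{b^*},\dot G\rangle_{\mathcal H}$ for all $\dot G\in\dot{\mathcal G}$. Hellinger differentiability at $P_{\theta,G}$: there is a bounded linear $\dot l:\mathbb R^k\times\dot{\mathcal G}\to L_2^0(P_{\theta,G})$ such that for all $\zeta\in\mathbb R^k$ and paths in $\mathcal C_G$ with tangent $\dot G$, $s(\theta+\eta\zeta,G_\eta)=s(\theta,G)+\frac12\eta\,\dot l(\zeta,\dot G)s(\theta,G)+o(\eta)$ in $L_2(\mu)$. Then $\dot l(\zeta,\dot G)=\dot l_1^\top\zeta+\dot l_2(\dot G)$, which defines the score operator $\dot l_2=\dot l_2(\theta,G):\dot{\mathcal G}\to L_2^0(P_{\theta,G})$.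 $\dot{\mathcal P}_2=\dot{\mathcal P}_2(\theta)$ is the closed linear span in $L_2^0(P_{\theta,G})$ of the functions $\dot l_2(\dot G)$ obtained from paths in $\mathcal C_G$ (tangent space of the submodel with $\theta$ known). Efficient score and information: $l_1^*(\theta)=\dot l_1(\theta)-\Pi(\dot l_1(\theta)\mid\dot{\mathcal P}_2)$ (componentwise $L_2(P_{\theta,G})$-projection), $I_*(\theta)=E_\theta(l_1^*l_1^{*\top})$. $\hat\theta_n$ is efficient in $\mathcal P$ (at $P_{\theta_0,G}$) if it is locally asymptotically linear in the efficient influence function: $\sqrt n|\hat\theta_n-\theta_n-\frac1n\sum_{i=1}^nI_*^{-1}(\theta_n)l_1^*(\theta_n)(X_i)|\to0$ in $P_{\theta_0,G}$-probability for all $\{\theta_n\}\subset\Theta$ with $\{\sqrt n(\theta_n-\theta_0)\}$ bounded. Influence functions: $(\dot l_2^\top\dot l_2)^-\alpha$ denotes any solution $h\in\dot{\mathcal G}$ of $\dot l_2^\top\dot l_2h=\alpha$. Put $\psi_h(x;\theta,G)=[\dot l_2(\theta,G)(\dot l_2^\top(\theta,G)\dot l_2(\theta,G))^-h](x)$ and $c_h(\theta)=-E_\theta(\psi_h(X_1;\theta,G)\dot l_1^\top(\theta)(X_1))$ for $h\in\dot{\mathcal G}$ for which this is defined (i.e. $h\in R(\dot l_2^\top\dot l_2)$); $\psi(x;\theta,G;b^* )=\psi_{h}(x;\theta,G)$ with $h=\dot{\tilde\nu}_{b^*}$, and $c(\theta,G;b^* )=-E_\theta(\psi(X_1;\theta,G;b^*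 )\dot l_1^\top(\theta)(X_1))$. *)

(* Defs.v *)
From HB Require Import structures.
From mathcomp Require Import all_boot all_order all_algebra.
From mathcomp Require Import all_classical all_reals all_analysis.

Set Implicit Arguments.
Unset Strict Implicit.
Unset Printing Implicit Defensive.
Import Order.TTheory GRing.Theory Num.Theory.
Import numFieldNormedType.Exports.

Local Open Scope classical_set_scope.
Local Open Scope ring_scope.

Section linear_spans.
Context {R : realType}.

Definition lin_span {V : lmodType R} (S : set V) : set V :=
  [set v | exists (n : nat) (a : 'I_n -> R) (g : 'I_n -> V),
     (forall i, S (g i)) /\ v = \sum_(i < n) a i *: g i].

Definition closed_span {V : normedModType R} (S : set V) : set V :=
  closure (lin_span S).

(* A completeNormedModType with an inner product in this sense is a real
   Hilbert space. *)
Definition is_inner_product {H : normedModType R} (dot : H -> H -> R) :=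
  [/\ forall x y, dot x y = dot y x,
      forall a x y z, dot (a *: x + y) z = a * dot x z + dot y z &
      forall x, dot x x = `|x| ^+ 2].

Definition dual_space (B : normedModType R) : set (B -> R) :=
  [set b : B -> R | (forall a x y, b (a *: x + y) = a * b x + b y) /\ continuous b].

(* Operators defined on a subspace D are total functions constrained on D. *)
Definition bounded_linear_on {V W : normedModType R} (D : set V)
    (f : V -> W) :=
  (forall a x y, D x -> D y -> f (a *: x + y) = a *: f x + f y) /\
  (exists M : R, forall x, D x -> `|f x| <= M * `|x|).

End linear_spans.

Arguments dual_space {R} B _.

(* Elements of L_2 are represented by measurable functions; equality in L_2
   is equality almost everywhere. *)
Section square_integrable.
Context {R : realType} {d : measure_display} {T : measurableType d}.

Definition L2norm (mu : {measure set T -> \bar R}) (f : T -> R) : \bar R :=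
  Lnorm mu 2%:E (EFin \o f).

Definition L2norm_le (mu : {measure set T -> \bar R}) (f : T -> R) (r : R) :=
  (L2norm mu f <= r%:E)%E.

Definition L2 (mu : {measure set T -> \bar R}) : set (T -> R) :=
  [set f | f \in Lfun mu 2%:E].

Definition L20 (P : probability T R) : set (T -> R) :=
  [set f | L2 P f /\ \int[P]_x f x = 0].

Definition L2_closed_span (mu : {measure set T -> \bar R})
    (S : set (T -> R)) : set (T -> R) :=
  [set f | L2 mu f /\ forall e : R, 0 < e ->
     exists2 g : T -> R, lin_span S g & L2norm_le mu (f \- g) e].

Definition is_L2_projection (P : probability T R) (V : set (T -> R))
    (f pf : T -> R) :=
  V pf /\ forall g, V g -> \int[P]_x ((f x - pf x) * g x) = 0.

Definition is_root_density (mu : {measure set T -> \bar R})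
    (P : probability T R) (s : T -> R) :=
  [/\ measurable_fun setT s, forall x, 0 <= s x &
      forall A, measurable A -> P A = (\int[mu]_(x in A) ((s x) ^+ 2)%:E)%E].

End square_integrable.

Section regular_parametric_model.
Context {R : realType} {k : nat} {d : measure_display} {T : measurableType d}.
Variables (Theta : set 'cV[R]_k) (P : 'cV[R]_k -> probability T R).

Definition second_moment (Q : probability T R) (f : T -> 'cV[R]_k) : 'M[R]_k :=
  \matrix_(i, j) \int[Q]_x (f x i 0 * f x j 0).

Definition regular_model (score : 'cV[R]_k -> T -> 'cV[R]_k) :=
  exists (mu : {sigma_finite_measure set T -> \bar R})
         (s : 'cV[R]_k -> T -> R),
  [/\ forall th, Theta th -> is_root_density mu (P th) (s th),
      forall th, Theta th ->
        (forall i, L2 (P th) (fun x => score th x i 0)) /\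
        (forall e : R, 0 < e -> \forall th' \near th, Theta th' ->
           L2norm_le mu (fun x => s th' x - s th x
               - 2^-1 * ((th' - th)^T *m score th x) 0 0 * s th x)
             (e * `|th' - th|)),
      forall th, Theta th -> second_moment (P th) (score th) \in unitmx &
      forall th, Theta th -> forall (i : 'I_k) (e : R), 0 < e ->
        \forall th' \near th, Theta th' ->
          L2norm_le mu (fun x => score th' x i 0 * s th' x
                                 - score th x i 0 * s th x) e].

End regular_parametric_model.

Section paths.
Context {R : realType} {H : normedModType R}.

Definition is_path (calG : set H) (G : H) (p : R -> H) :=
  [/\ forall eta : R, `|eta| < 1 -> calG (p eta),
      p 0 = G,
      forall eta : R, `|eta| < 1 ->
        differentiable p eta /\ {for eta, continuous (derive1 p)} &
      forall eta : R, `|eta| < 1 -> derive1 p eta != 0].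

Definition tangent (p : R -> H) : H := derive1 p 0.

Definition tangents0 (C : set (R -> H)) : set H :=
  [set tangent p | p in C] `|` [set 0].

Definition tangent_space (C : set (R -> H)) : set H :=
  closed_span (tangents0 C).

Definition pathwise_derivative {B : normedModType R} (C : set (R -> H))
    (G : H) (nut : H -> B) (nudot : H -> B) :=
  bounded_linear_on (tangent_space C) nudot /\
  forall p, C p -> forall e : R, 0 < e -> \forall eta \near (0 : R),
    `|nut (p eta) - nut G - eta *: nudot (tangent p)| <= e * `|eta|.

Definition is_gradient {B : normedModType R} (dot : H -> H -> R)
    (C : set (R -> H)) (nudot : H -> B) (b : B -> R) (h : H) :=
  tangent_space C h /\
  forall g, tangent_space C g -> b (nudot g) = dot h g.

Definition gradient {B : normedModType R} (dot : H -> H -> R)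
    (C : set (R -> H)) (nudot : H -> B) (b : B -> R) : H :=
  get (is_gradient dot C nudot b).

End paths.

Section score_operator.
Context {R : realType} {k : nat} {d : measure_display} {T : measurableType d}.
Context {H : normedModType R}.

(* The total score (zeta, Gdot) |-> l1^T zeta + l2(Gdot). *)
Definition total_score (l1 : T -> 'cV[R]_k) (l2 : H -> T -> R)
    (zeta : 'cV[R]_k) (g : H) : T -> R :=
  fun x => ((l1 x)^T *m zeta) 0 0 + l2 g x.

(* The dominating measure and the root densities may depend on the path. *)
Definition hellinger_derivative (Theta : set 'cV[R]_k)
    (P : 'cV[R]_k -> H -> probability T R) (C : set (R -> H))
    (th : 'cV[R]_k) (G : H) (ldot : 'cV[R]_k -> H -> T -> R) :=
  [/\ forall zeta g, tangent_space C g -> L20 (P th G) (ldot zeta g),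
      forall a zeta zeta' g g', tangent_space C g -> tangent_space C g' ->
        {ae P th G, forall x, ldot (a *: zeta + zeta') (a *: g + g') x
                              = a * ldot zeta g x + ldot zeta' g' x},
      exists M : R, forall zeta g, tangent_space C g ->
        L2norm_le (P th G) (ldot zeta g) (M * (`|zeta| + `|g|)) &
      forall zeta p, C p ->
        exists (mu : {sigma_finite_measure set T -> \bar R})
               (s : R -> T -> R),
          (forall eta : R, `|eta| < 1 -> Theta (th + eta *: zeta) ->
             is_root_density mu (P (th + eta *: zeta) (p eta)) (s eta)) /\
          (forall e : R, 0 < e -> \forall eta \near (0 : R),
             L2norm_le mu (fun x => s eta x - s 0 x
                 - 2^-1 * eta * ldot zeta (tangent p) x * s 0 x)
               (e * `|eta|))].

(* The tangent space of the submodel with theta known. *)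
Definition nuisance_space (Q : probability T R) (C : set (R -> H))
    (l2 : H -> T -> R) : set (T -> R) :=
  L2_closed_span Q [set l2 (tangent p) | p in C].

Definition is_efficient_score (Q : probability T R) (C : set (R -> H))
    (l1 : T -> 'cV[R]_k) (l2 : H -> T -> R) (ls : T -> 'cV[R]_k) :=
  forall i : 'I_k, measurable_fun setT (fun x => ls x i 0) /\
    exists2 pf, is_L2_projection Q (nuisance_space Q C l2)
                  (fun x => l1 x i 0) pf &
      {ae Q, forall x, ls x i 0 = l1 x i 0 - pf x}.

Definition adjoint_score (Q : probability T R) (dot : H -> H -> R)
    (C : set (R -> H)) (l2 : H -> T -> R) (f : T -> R) : H :=
  get [set h | tangent_space C h /\
    forall g, tangent_space C g -> dot h g = \int[Q]_x (f x * l2 g x)].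

Definition info_operator (Q : probability T R) (dot : H -> H -> R)
    (C : set (R -> H)) (l2 : H -> T -> R) (g : H) : H :=
  adjoint_score Q dot C l2 (l2 g).

Definition info_range (Q : probability T R) (dot : H -> H -> R)
    (C : set (R -> H)) (l2 : H -> T -> R) : set H :=
  [set info_operator Q dot C l2 g | g in tangent_space C].

(* f is a version of l2 applied to a solution of (l2^T l2) g = h. *)
Definition is_influence (Q : probability T R) (dot : H -> H -> R)
    (C : set (R -> H)) (l2 : H -> T -> R) (h : H) (f : T -> R) :=
  exists g, [/\ tangent_space C g, info_operator Q dot C l2 g = h &
                {ae Q, forall x, f x = l2 g x}].

Definition score_correlation (Q : probability T R) (f : T -> R)
    (l1 : T -> 'cV[R]_k) : 'rV[R]_k :=
  \row_i (- \int[Q]_x (f x * l1 x i 0)).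

End score_operator.

(* R^k is identified with k-tuples, which carry the product Borel
   sigma-algebra. *)
Definition col_of_tuple {R : realType} {k : nat} (v : k.-tuple R) : 'cV[R]_k :=
  \col_i tnth v i.

Definition jointly_measurable {R : realType} {k : nat} {d : measure_display}
    {T : measurableType d} (D : set 'cV[R]_k) (f : T -> 'cV[R]_k -> R) :=
  measurable_fun [set z : T * k.-tuple R | D (col_of_tuple z.2)]
    (fun z => f z.1 (col_of_tuple z.2)).

Section sampling.
Context {R : realType} {dO d : measure_display}.
Context {Om : measurableType dO} {T : measurableType d}.

Definition iid (Pr : probability Om R) (Q : probability T R)
    (X : nat -> Om -> T) :=
  [/\ forall i, measurable_fun setT (X i),
      forall i A, measurable A -> Pr (X i @^-1` A) = Q A &
      forall (s : seq nat) (A : nat -> set T), uniq s ->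
        (forall i, measurable (A i)) ->
        Pr (\big[setI/setT]_(i <- s) (X i @^-1` A i))
        = (\prod_(i <- s) Pr (X i @^-1` A i))%E].

(* (X_{m+1}, ..., X_{m+n}), the observations being numbered from 0. *)
Definition sample (X : nat -> Om -> T) (m n : nat) (w : Om) : n.-tuple T :=
  [tuple X (m + i)%N w | i < n].

Definition cvg_in_probability (Pr : probability Om R) (Y : nat -> Om -> R) :=
  forall e : R, 0 < e -> Pr [set w | e < `|Y n w|] @[n --> \oo] --> 0%E.

End sampling.

Definition root_n_local {R : realType} {k : nat} (Theta : set 'cV[R]_k)
    (th0 : 'cV[R]_k) (th : nat -> 'cV[R]_k) :=
  (forall n, Theta (th n)) /\
  exists M : R, forall n, `|Num.sqrt n%:R *: (th n - th0)| <= M.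

Definition split_estimator {R : realType} {k : nat} {d : measure_display}
    {T : measurableType d} {dO : measure_display} {Om : measurableType dO}
    {B : normedModType R} (X : nat -> Om -> T)
    (t : forall n, n.-tuple T -> 'cV[R]_k)
    (u : forall n, n.-tuple T -> 'cV[R]_k -> B)
    (lam : nat -> nat) (n : nat) (w : Om) : B :=
  let l := lam n in
  let S1 := sample X 0 l w in
  let S2 := sample X l (n - l) w in
  (l%:R / n%:R) *: u l S1 (t (n - l)%N S2)
  + ((n - l)%:R / n%:R) *: u (n - l)%N S2 (t l S1).

(* Main.v *)
Require Import Defs.
From HB Require Import structures.
From mathcomp Require Import all_boot all_order all_algebra.
From mathcomp Require Import zify ring lra.
From mathcomp Require Import all_classical all_reals all_analysis.
From mathcomp Require Import measurable_realfun.
Set Implicit Arguments.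
Unset Strict Implicit.
Unset Printing Implicit Defensive.
Import Order.TTheory GRing.Theory Num.Theory.
Import numFieldNormedType.Exports.
Local Open Scope classical_set_scope.
Local Open Scope ring_scope.

(* Write c for the correlation c(theta_0, G; b) and kappa for the efficient influence
   function of theta.  Hypotheses (3) and (4) say that, along every
   root-n local sequence theta_n,
     sqrt n b(u_n(theta_n) - nu)
       = n^{-1/2} sum psi(X_i; theta_0) + c sqrt n (theta_n - theta_0) + o_P(1).
   A choice argument makes this uniform over root-n neighbourhoods of theta_0, and since
   the estimator of theta inserted in each half is computed from the other, independent
   half and is root-n tight, Fubini's theorem allows it to replace theta_n.  Inserting its
   linear expansion (5) and using that the halves have asymptotically equal sizes yields
     sqrt n b(nu_n - nu) = n^{-1/2} sum (psi + c kappa)(X_i; theta_0) + o_P(1).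
   Finally (3), (5) and c(theta_n) -> c(theta_0) move the influence function from theta_0
   to theta_n: the two shifts by c sqrt n (theta_n - theta_0) cancel. *)

(** The obstacle is that (3) and (4) speak of deterministic sequences only, while the parameter
    actually inserted is random. What the choice argument yields is a bound on the supremum over the
    neighbourhood of the probabilities, not on the probability of a supremum. This weaker form is
    just what Fubini's theorem consumes, one frozen parameter value at a time, and it involves no
    supremum whose measurability would have to be settled. Crossing the halves has a price: the
    nuisance estimator of one half receives the error in theta of the other, so the sums of kappa
    over the two halves come with exchanged weights. The discrepancy is a vanishing factor times a
    normalized sum of kappa, hence the need for kappa to be centred and square integrable. All
    probabilities are taken under the law at theta_0, also when the expansion is centred at theta_n.
    No change of measure occurs: (5) at theta_n is compared with (5) at theta_0. The space B carries
    no sigma-algebra, so every random quantity is made real by applying b first. *)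

Section rectangles.
Context {d : measure_display} {T : measurableType d}.

Definition rectangle (n : nat) (A : nat -> set T) : set (n.-tuple T) :=
  [set x | forall i : 'I_n, A i (tnth x i)].

#[local] Arguments rectangle : clear implicits.

Definition rectangles (n : nat) : set (set (n.-tuple T)) :=
  [set rectangle n A | A in [set A | forall i, measurable (A i)]].

#[local] Arguments rectangles : clear implicits.

Lemma rectanglesT n : rectangles n setT.
Proof. by exists (fun=> setT) => //=; apply/seteqP; split. Qed.

Lemma rectangles_setI n : setI_closed (rectangles n).
Proof.
move=> _ _ [A mA <-] [B mB <-]; exists (fun i => A i `&` B i) => /=.
  by move=> i; apply: measurableI.
apply/seteqP; split => [x h|x [h1 h2] i]; last by split.
by split => i; have [] := h i.
Qed.

Lemma measurable_rectangle n A : (forall i, measurable (A i)) ->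
  measurable (rectangle n A).
Proof.
move=> mA; have -> : rectangle n A =
    \big[setI/setT]_(i < n) ((@tnth n T ^~ i) @^-1` A i).
  by rewrite -bigcap_seq; apply/seteqP; split => [x h i _|x h i];
    [exact: h | apply: h; rewrite /= mem_index_enum].
apply: bigsetI_measurable => i _.
by rewrite -[X in measurable X]setTI; exact: measurable_tnth.
Qed.

(** The product sigma-algebra is generated by preimages under single coordinates, and these are
    rectangles with all other sides equal to [setT]. Rectangles have the advantage of being stable
    under intersection, so that measures agreeing on them agree everywhere. *)
Lemma measurable_tupleE n : @measurable _ (n.-tuple T) = <<s rectangles n >>.
Proof.
apply/seteqP; split; last first.
  apply: smallest_sub; first exact: sigma_algebra_measurable.
  by move=> _ [A mA <-]; exact: measurable_rectangle.
apply: smallest_sub; first exact: smallest_sigma_algebra.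
move=> B; rewrite -bigcup_seq => -[i _ [A mA <-]].
apply: sub_sigma_algebra.
exists (fun j => if j == i :> nat then A else setT) => /=.
  by move=> j; case: ifP.
rewrite setTI; apply/seteqP; split => [x /(_ i)|x Ax j]; rewrite ?eqxx//.
by case: eqP => // /val_inj ->.
Qed.

Lemma tuple_measure_unique {R : realType} n
    (m1 m2 : {measure set (n.-tuple T) -> \bar R}) :
  (m1 setT < +oo)%E -> (forall A, rectangles n A -> m1 A = m2 A) ->
  forall A, measurable A -> m1 A = m2 A.
Proof.
move=> m1oo m12; apply: (measure_unique (rectangles n) (fun=> setT)) => //.
- exact: measurable_tupleE.
- exact: rectangles_setI.
- by move=> _; exact: rectanglesT.
- by rewrite bigcup_const//; exists 0%N.
Qed.

End rectangles.
Arguments rectangle {d T} n A.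
Arguments rectangles {d} T n.

(** * Independent blocks of observations and Fubini's theorem *)

Section joint_distribution.
Context {R : realType} {dO d1 d2 : measure_display}.
Context {Om : measurableType dO} {T1 : measurableType d1} {T2 : measurableType d2}.
Variables (Pr : probability Om R).
Local Open Scope ereal_scope.

Lemma joint_distribution (S1 : {mfun Om >-> T1}) (S2 : {mfun Om >-> T2}) :
  (forall A B, measurable A -> measurable B ->
    Pr (S1 @^-1` A `&` S2 @^-1` B) = Pr (S1 @^-1` A) * Pr (S2 @^-1` B)) ->
  forall C, measurable C -> (distribution Pr S1 \x distribution Pr S2) C =
                            Pr [set w | C (S1 w, S2 w)].
Proof.
move=> SI C mC.
have mS : measurable_fun setT (fun w => (S1 w, S2 w)) by exact: measurable_fun_pair.
pose S := mfun_Sub (mem_set mS).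
apply: (@product_measure_unique _ _ _ _ _ _ _ (distribution Pr S)) => //.
Qed.

(** Independence lets [S2] be frozen at a value [y]: the joint law is a product, so the probability
    is an average over [y] of quantities that are all at most [e]. *)
Lemma section_bound (S1 : {mfun Om >-> T1}) (S2 : {mfun Om >-> T2}) :
  (forall A B, measurable A -> measurable B ->
    Pr (S1 @^-1` A `&` S2 @^-1` B) = Pr (S1 @^-1` A) * Pr (S2 @^-1` B)) ->
  forall (C : set (T1 * T2)) (e : \bar R), measurable C ->
  (forall y, Pr (S1 @^-1` [set x | C (x, y)]) <= e) ->
  Pr [set w | C (S1 w, S2 w)] <= e.
Proof.
move=> SI C e mC Ce; rewrite -(joint_distribution SI mC).
(* The product [\x] is an integral over the first coordinate, whereas the bound concerns sections at
   a fixed second one; uniqueness of the product measure exchanges the order. *)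
rewrite (@product_measure_unique _ _ _ _ _ _ _
  (distribution Pr S1 \x^ distribution Pr S2))//; last first.
  by move=> A B mA mB /=; rewrite product_measure2E.
rewrite /product_measure2.
have mys := measurable_fun_ysection (distribution Pr S1) mC.
have Ce' y : distribution Pr S1 (ysection C y) <= e.
  by rewrite ysectionE; exact: Ce.
apply: (@le_trans _ _ (\int[distribution Pr S2]_y cst e y)).
  apply: ge0_le_integral => //=.
by rewrite integral_cst// [X in _ * X]probability_setT mule1.
Qed.

End joint_distribution.

Section blocks.
Context {R : realType} {dO d : measure_display}.
Context {Om : measurableType dO} {T : measurableType d}.
Variables (Pr : probability Om R) (Q : probability T R) (X : nat -> Om -> T).
Hypothesis X_iid : iid Pr Q X.
Local Open Scope ereal_scope.

Lemma measurable_sample a n : measurable_fun setT (sample X a n).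
Proof.
apply/measurable_fun_tnthP => i; case: X_iid => mX _ _.
rewrite (_ : _ \o _ = X (a + i)%N)//.
by apply/funext => w /=; rewrite tnth_mktuple.
Qed.

Let measurable_sample_preim a n A : measurable A ->
  measurable (sample X a n @^-1` A).
Proof. by rewrite -[X in _ -> measurable X]setTI; apply: measurable_sample. Qed.

Lemma sample_rectangle a n A : sample X a n @^-1` rectangle n A =
  \big[setI/setT]_(i <- iota a n) (X i @^-1` A (i - a)%N).
Proof.
rewrite -bigcap_seq; apply/seteqP; split => [w /= h i|w h i].
  rewrite /= mem_iota => /andP[ai ian].
  have ian' : (i - a < n)%N by rewrite ltn_subLR.
  have := h (Ordinal ian'); rewrite tnth_mktuple/=.
  by rewrite /mkset subnKC.
have := h (a + i)%N; rewrite /= mem_iota leq_addr ltn_add2l ltn_ord => /(_ isT).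
by rewrite addKn tnth_mktuple.
Qed.

Lemma prob_rectangle a n A : (forall i, measurable (A i)) ->
  Pr (sample X a n @^-1` rectangle n A) = \prod_(i <- iota 0 n) Q (A i).
Proof.
move=> mA; case: X_iid => mX XQ XI.
rewrite sample_rectangle (XI _ (fun i => A (i - a)%N))//; last exact: iota_uniq.
rewrite -[in iota a n](addn0 a) iotaDl big_map; apply: eq_bigr => i _.
by rewrite XQ// addKn.
Qed.

(** For a fixed event [E] both sides are finite measures in [A]: the image of [Pr] restricted to
    [E], and a multiple of the image of [Pr]. Keeping [E] arbitrary allows the two blocks of
    [sample_indep] to be treated one after the other. *)
Lemma sample_indep_extend a n (E : set Om) : measurable E ->
  (forall A, rectangles T n A -> Pr (sample X a n @^-1` A `&` E) =
                                 Pr E * Pr (sample X a n @^-1` A)) ->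
  forall A, measurable A -> Pr (sample X a n @^-1` A `&` E) =
                            Pr E * Pr (sample X a n @^-1` A).
Proof.
move=> mE h A mA.
have mS := @measurable_sample a n.
pose PS : {measure set (n.-tuple T) -> \bar R} :=
  measure_function_pushforward__canonical__measure_function_Measure Pr mS.
pose PE : {measure set (n.-tuple T) -> \bar R} :=
  measure_function_pushforward__canonical__measure_function_Measure (mrestr Pr mE) mS.
have PE0 : (0 <= fine (Pr E))%R by exact: fine_ge0.
have := @tuple_measure_unique _ T R n PE (mscale (NngNum PE0) PS).
rewrite /= /pushforward/= /mrestr /mscale/= /pushforward/= fineK ?fin_num_measure//.
apply => //; first by rewrite preimage_setT setTI ltey_eq fin_num_measure.
Qed.

Lemma sample_distr a n A : measurable A ->
  Pr (sample X a n @^-1` A) = Pr (sample X 0 n @^-1` A).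
Proof.
move=> mA.
pose PS b : {measure set (n.-tuple T) -> \bar R} :=
  measure_function_pushforward__canonical__measure_function_Measure
    Pr (@measurable_sample b n).
apply: (@tuple_measure_unique _ T R n (PS a) (PS 0%N)) => //.
- by rewrite /= /pushforward preimage_setT ltey_eq fin_num_measure.
- by move=> _ [C mC <-]; rewrite /= /pushforward !prob_rectangle.
Qed.

Lemma sample_indep a l b m A B : (a + l <= b)%N || (b + m <= a)%N ->
  measurable A -> measurable B ->
  Pr (sample X a l @^-1` A `&` sample X b m @^-1` B) =
  Pr (sample X a l @^-1` A) * Pr (sample X b m @^-1` B).
Proof.
move=> ab mA mB.
have mSA := @measurable_sample_preim a l A mA.
rewrite setIC; move: B mB; apply: sample_indep_extend => // B [B' mB' <-].
have mSB := @measurable_sample_preim b m _ (measurable_rectangle mB').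
rewrite setIC muleC; move: A mA {mSA}; apply: sample_indep_extend; first exact: mSB.
move=> _ [A' mA' <-].
(* The independence clause of [iid] takes one family of sets over one duplicate-free list of
   indices. As the blocks are disjoint, their sides can be glued into a single family over the
   concatenated list. *)
pose C i := if i \in iota a l then A' (i - a)%N else B' (i - b)%N.
have mC i : measurable (C i) by rewrite /C; case: ifP.
have Ca i : i \in iota a l -> C i = A' (i - a)%N by rewrite /C => ->.
have Cb i : i \in iota b m -> C i = B' (i - b)%N.
  rewrite /C !mem_iota => /andP[bi ib]; case: ifP => // /andP[ai ia].
  by case/orP: ab => ab; lia.
rewrite !sample_rectangle.
rewrite (eq_big_seq (fun i => X i @^-1` C i)); last by move=> i /Ca ->.
rewrite (eq_big_seq (fun i => X i @^-1` C i) _ (r := iota b m)); last first.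
  by move=> i /Cb ->.
case: X_iid => mX XQ XI; rewrite -big_cat !XI ?iota_uniq//.
  by rewrite big_cat muleC.
rewrite cat_uniq !iota_uniq andbT/=; apply/hasPn => i.
by rewrite !mem_iota; case/orP: ab => ab; lia.
Qed.

Lemma sample_section_bound a l b m (C : set (l.-tuple T * m.-tuple T)) (e : \bar R) :
  (a + l <= b)%N || (b + m <= a)%N -> measurable C ->
  (forall y, Pr (sample X a l @^-1` [set x | C (x, y)]) <= e) ->
  Pr [set w | C (sample X a l w, sample X b m w)] <= e.
Proof.
move=> ab mC Ce.
pose S1 : {mfun Om >-> l.-tuple T} := mfun_Sub (mem_set (@measurable_sample a l)).
pose S2 : {mfun Om >-> m.-tuple T} := mfun_Sub (mem_set (@measurable_sample b m)).
have SI A B : measurable A -> measurable B ->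
    Pr (S1 @^-1` A `&` S2 @^-1` B) = Pr (S1 @^-1` A) * Pr (S2 @^-1` B).
  exact: sample_indep.
exact: (section_bound SI mC).
Qed.

End blocks.

(** * Calculus of negligible and tight sequences *)

Section stochastic_order.
Context {R : realType} {dO : measure_display} {Om : measurableType dO}.
Variable Pr : probability Om R.
Implicit Types (Y Z : nat -> Om -> R) (a : nat -> R).

(** Measurability is bundled because the closure rules rest on monotonicity and subadditivity of
    [Pr] on tail events. Eventual real bounds replace limits in the extended reals, which makes
    splitting the tolerance immediate. *)
Definition oP Y := (forall n, measurable_fun setT (Y n)) /\
  forall e c : R, 0 < e -> 0 < c ->
    \forall n \near \oo, (Pr [set w | (e < `|Y n w|)%R] <= c%:E)%E.

Definition OP Y := (forall n, measurable_fun setT (Y n)) /\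
  forall c : R, 0 < c -> exists2 M : R, 0 < M &
    \forall n \near \oo, (Pr [set w | (M < `|Y n w|)%R] <= c%:E)%E.

Lemma measurable_tail (f : Om -> R) (e : R) : measurable_fun setT f ->
  measurable [set w | e < `|f w|].
Proof.
move=> mf; rewrite -[X in measurable X]setTI.
have -> : [set w | e < `|f w|] = (Num.norm \o f) @^-1` `]e, +oo[.
  by apply/seteqP; split => w /=; rewrite in_itv/= andbT.
by apply: measurableT_comp => //; exact: measurable_itv.
Qed.

Lemma oP_cvg Y : (forall n, measurable_fun setT (Y n)) ->
  cvg_in_probability Pr Y <-> oP Y.
Proof.
move=> mY; split => [h|[_ h] e e0].
  split=> // e c e0 c0; have := h e e0.
  have : nbhs (0 : \bar R)%E [set x : \bar R | (x < c%:E)%E].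
    apply: open_nbhs_nbhs; split; first exact: open_ereal_lt_ereal.
    by rewrite /= lte_fin.
  move=> nb h'; near=> n; apply: ltW; near: n; exact: (h' _ nb).
have mt n : measurable [set w | e < `|Y n w|] by exact: measurable_tail.
apply/fine_cvgP; split; first by apply: nearW => n; rewrite fin_num_measure.
apply/cvgrPdist_le => c c0; have := h e c e0 c0; apply: filterS => n.
rewrite sub0r normrN /= ger0_norm ?fine_ge0// -lee_fin fineK//.
by rewrite fin_num_measure.
Unshelve. all: by end_near. Qed.

Lemma prob_le (A B : set Om) (c : \bar R) : measurable A -> measurable B ->
  A `<=` B -> (Pr B <= c)%E -> (Pr A <= c)%E.
Proof. by move=> mA mB AB; apply: le_trans; rewrite le_measure ?inE. Qed.

Lemma prob_leU (A B C : set Om) (b c : \bar R) :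
  measurable A -> measurable B -> measurable C ->
  A `<=` B `|` C -> (Pr B <= b)%E -> (Pr C <= c)%E -> (Pr A <= b + c)%E.
Proof.
move=> mA mB mC AB Bb Cc.
apply: (le_trans (le_measure Pr _ _ AB)); rewrite ?inE//; first exact: measurableU.
exact: le_trans (measureU2 Pr mB mC) (leeD Bb Cc).
Qed.

Lemma oP_le Y Z : (forall n, measurable_fun setT (Y n)) ->
  (\forall n \near \oo, forall w, `|Y n w| <= `|Z n w|) -> oP Z -> oP Y.
Proof.
move=> mY YZ [mZ hZ]; split => // e c e0 c0.
near=> n; have YZn : forall w, `|Y n w| <= `|Z n w| by near: n.
apply: (@prob_le _ [set w | e < `|Z n w|]).
- exact: measurable_tail.
- exact: measurable_tail.
- by move=> w /= /lt_le_trans; apply.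
- by near: n; exact: hZ.
Unshelve. all: by end_near. Qed.

Lemma oP_ext Y Z : (forall n, measurable_fun setT (Y n)) ->
  (\forall n \near \oo, forall w, Y n w = Z n w) -> oP Z -> oP Y.
Proof.
move=> mY YZ; apply: oP_le => //.
by apply: filterS YZ => n YZn w; rewrite YZn.
Qed.

Lemma oPD Y Z : oP Y -> oP Z -> oP (fun n w => Y n w + Z n w).
Proof.
move=> [mY hY] [mZ hZ]; split=> [n|e c e0 c0]; first exact: measurable_funD.
near=> n; rewrite [c]splitr EFinD.
apply: (@prob_leU _ [set w | e / 2 < `|Y n w|] [set w | e / 2 < `|Z n w|]).
- by apply: measurable_tail; exact: measurable_funD.
- exact: measurable_tail.
- exact: measurable_tail.
- move=> w /= h; apply/orP; rewrite -implyNb -leNgt; apply/implyP => Yn.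
  have := ler_normD (Y n w) (Z n w); lra.
- by near: n; apply: hY; rewrite divr_gt0.
- by near: n; apply: hZ; rewrite divr_gt0.
Unshelve. all: by end_near. Qed.

Lemma OPD Y Z : OP Y -> OP Z -> OP (fun n w => Y n w + Z n w).
Proof.
move=> [mY hY] [mZ hZ]; split=> [n|c c0]; first exact: measurable_funD.
have c20 : 0 < c / 2 by rewrite divr_gt0.
have [M M0 hM] := hY _ c20; have [N N0 hN] := hZ _ c20.
exists (M + N); first exact: addr_gt0.
near=> n; rewrite [c]splitr EFinD.
apply: (@prob_leU _ [set w | M < `|Y n w|] [set w | N < `|Z n w|]).
- by apply: measurable_tail; exact: measurable_funD.
- exact: measurable_tail.
- exact: measurable_tail.
- move=> w /= h; apply/orP; rewrite -implyNb -leNgt; apply/implyP => Yn.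
  have := ler_normD (Y n w) (Z n w); lra.
- by near: n.
- by near: n.
Unshelve. all: by end_near. Qed.

Lemma oP_OP Y : oP Y -> OP Y.
Proof. by move=> [mY hY]; split=> // c c0; exists 1 => //; exact: hY. Qed.

Lemma OP_oP_scale a Y : a @ \oo --> (0 : R) -> OP Y -> oP (fun n w => a n * Y n w).
Proof.
move=> a0 [mY hY]; split=> [n|e c e0 c0]; first exact: measurable_funM.
have [M M0 hM] := hY _ c0; near=> n.
apply: (@prob_le _ [set w | M < `|Y n w|]).
- by apply: measurable_tail; exact: measurable_funM.
- exact: measurable_tail.
- move=> w /=; rewrite normrM; apply: contraTT; rewrite -!leNgt => YM.
  have an : `|a n| <= e / M.
    rewrite -[a n]opprK normrN -sub0r; near: n.
    by move/cvgrPdist_le : a0; apply; rewrite divr_gt0.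
  apply: (le_trans (ler_pM _ _ an YM)) => //.
  by rewrite divfK// gt_eqF.
- by near: n.
Unshelve. all: by end_near. Qed.

Lemma oP_scale a Y (K : R) : (\forall n \near \oo, `|a n| <= K) -> oP Y ->
  oP (fun n w => a n * Y n w).
Proof.
move=> aK [mY hY]; split=> [n|e c e0 c0]; first exact: measurable_funM.
have K0 : 0 < `|K| + 1 by rewrite ltr_wpDl.
near=> n; apply: (@prob_le _ [set w | e / (`|K| + 1) < `|Y n w|]).
- by apply: measurable_tail; exact: measurable_funM.
- exact: measurable_tail.
- move=> w /=; rewrite normrM ltr_pdivrMr// mulrC => /lt_le_trans; apply.
  apply: ler_wpM2l => //.
  have : `|a n| <= K by near: n.
  have := ler_norm K; lra.
- by near: n; apply: hY => //; rewrite divr_gt0.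
Unshelve. all: by end_near. Qed.

Lemma OP_scale a Y (K : R) : (\forall n \near \oo, `|a n| <= K) -> OP Y ->
  OP (fun n w => a n * Y n w).
Proof.
move=> aK [mY hY]; split=> [n|c c0]; first exact: measurable_funM.
have K0 : 0 < `|K| + 1 by rewrite ltr_wpDl.
have [M M0 hM] := hY _ c0; exists ((`|K| + 1) * M); first exact: mulr_gt0.
near=> n; apply: (@prob_le _ [set w | M < `|Y n w|]).
- by apply: measurable_tail; exact: measurable_funM.
- exact: measurable_tail.
- move=> w /=; apply: contraTT; rewrite -!leNgt normrM => YM.
  apply: ler_pM => //.
  have : `|a n| <= K by near: n.
  have := ler_norm K; lra.
- by near: n.
Unshelve. all: by end_near. Qed.

Lemma OP_cst a (K : R) : (\forall n \near \oo, `|a n| <= K) ->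
  OP (fun n _ => a n).
Proof.
move=> aK; split=> [n|c c0]; first exact: measurable_cst.
exists (`|K| + 1); first by rewrite ltr_wpDl.
near=> n; rewrite (_ : [set w | _] = set0) ?measure0 ?lee_fin 1?ltW//.
apply/seteqP; split => // w /=.
have : `|a n| <= K by near: n.
by have := ler_norm K; lra.
Unshelve. all: by end_near. Qed.

Lemma oP0 : oP (fun _ _ => 0).
Proof.
split=> [n|e c e0 c0]; first exact: measurable_cst.
apply: nearW => n; rewrite (_ : [set w | _] = set0) ?measure0 ?lee_fin 1?ltW//.
by apply/seteqP; split => // w /=; rewrite normr0 ltNge (ltW e0).
Qed.

Lemma oP_sum k (Y : 'I_k -> nat -> Om -> R) : (forall j, oP (Y j)) ->
  oP (fun n w => \sum_(j < k) Y j n w).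
Proof.
elim: k Y => [|k IH] Y hY.
  have -> : (fun n w => \sum_(j < 0) Y j n w) = fun _ _ => 0.
    by apply/funext => n; apply/funext => w; rewrite big_ord0.
  exact: oP0.
have -> : (fun n w => \sum_(j < k.+1) Y j n w) = fun n w =>
    \sum_(j < k) Y (widen_ord (leqnSn k) j) n w + Y ord_max n w.
  by apply/funext => n; apply/funext => w; rewrite big_ord_recr.
by apply: oPD => //; apply: IH => j; exact: hY.
Qed.

Lemma OP_norm Y : OP Y -> OP (fun n w => `|Y n w|).
Proof.
move=> [mY hY]; split=> [n|c /hY[M M0 hM]]; first exact: measurableT_comp.
exists M => //; apply: filterS hM => n.
rewrite (_ : [set w | (M < `|Y n w|)%R] = [set w | (M < `| `|Y n w| |)%R])//.
by apply/seteqP; split => w /=; rewrite normr_id.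
Qed.

Lemma OP_ext Y Z : (forall n, measurable_fun setT (Y n)) ->
  (\forall n \near \oo, forall w, Y n w = Z n w) -> OP Z -> OP Y.
Proof.
move=> mY YZ [_ hZ]; split=> // c /hZ[M M0 hM]; exists M => //.
apply: filterS2 YZ hM => n YZn.
rewrite (_ : [set w | (M < `|Z n w|)%R] = [set w | (M < `|Y n w|)%R])//.
by apply/seteqP; split => w /=; rewrite YZn.
Qed.

Lemma OP_sum k (Y : 'I_k -> nat -> Om -> R) : (forall j, OP (Y j)) ->
  OP (fun n w => \sum_(j < k) Y j n w).
Proof.
elim: k Y => [|k IH] Y hY.
  have -> : (fun n w => \sum_(j < 0) Y j n w) = fun _ _ => 0.
    by apply/funext => n; apply/funext => w; rewrite big_ord0.
  exact/oP_OP/oP0.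
have -> : (fun n w => \sum_(j < k.+1) Y j n w) = fun n w =>
    \sum_(j < k) Y (widen_ord (leqnSn k) j) n w + Y ord_max n w.
  by apply/funext => n; apply/funext => w; rewrite big_ord_recr.
by apply: OPD => //; apply: IH => j; exact: hY.
Qed.

End stochastic_order.

(** * Second moments and tightness of normalized sums *)

Section L2_means.
Context {R : realType} {d : measure_display} {T : measurableType d}.
Local Open Scope ereal_scope.

Lemma Lfun2P (mu : {measure set T -> \bar R}) (f : T -> R) :
  f \in Lfun mu 2%:E <->
  measurable_fun setT f /\ \int[mu]_x ((f x) ^+ 2)%:E < +oo.
Proof.
split=> [f2|[mf fi]].
  have mf : measurable_fun setT f.
    by move: f2; rewrite inE => /andP[/[!inE]].
  split=> //; have /integrableP[_] := Lfun2_integrable_sqr f2.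
  by under eq_integral do rewrite gee0_abs/= ?lee_fin ?sqr_ge0//.
rewrite inE; apply/andP; split; rewrite inE//=.
rewrite /finite_norm unlock poweR_lty//.
rewrite (eq_integral (fun x => (f x ^+ 2)%:E))// => x _ /=.
by rewrite powR_mulrn// real_normK// num_real.
Qed.

(** The mean is continuous in L_2 of a probability: Hölder's inequality against the constant 1,
    whose norm is 1, bounds the mean of [f - g] by its L_2 norm. *)
Lemma L2_mean0_limit (Q : probability T R) (f : T -> R) : L2 Q f ->
  (forall e : R, (0 < e)%R -> exists2 g : T -> R, L20 Q g & L2norm_le Q (f \- g)%R e) ->
  (\int[Q]_x f x = 0)%R.
Proof.
move=> f2 fg; have Qfin : Q setT \is a fin_num by rewrite fin_num_measure.
have L2i (u : T -> R) : L2 Q u -> Q.-integrable setT (EFin \o u).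
  by move=> u2; apply/Lfun1_integrable; exact: Lfun_subset12 u2.
apply/eqP; rewrite -normr_le0; apply/ler_addgt0Pl => e e0; rewrite addr0.
have [g [g2 g0] /= ge] := fg _ e0.
have fi := L2i _ f2; have gi := L2i _ g2.
have -> : (\int[Q]_x f x = \int[Q]_x (f x - g x))%R.
  by rewrite RintegralB// g0 subr0.
have mf : measurable_fun setT f by have /Lfun2P[] := f2.
have mg : measurable_fun setT g by have /Lfun2P[] := g2.
have mfg : measurable_fun setT (f \- g)%R by exact: measurable_funB.
have fgi : Q.-integrable setT (EFin \o (f \- g)%R).
  by have := integrableB measurableT fi gi; apply: eq_integrable.
rewrite -lee_fin -abse_EFin /Rintegral fineK; last exact: integrable_fin_num.
apply: (le_trans (le_abse_integral Q measurableT _)).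
  exact/measurable_EFinP.
have := @hoelder _ _ _ Q _ _ 2%R 2%R mfg (measurable_cst (1 : R)%R).
rewrite [X in _ * X]Lnorm_cst1 [X in X `^ _]probability_setT poweR1r.
rewrite mule1 Lnorm1 => H; apply: (le_trans _ (le_trans (H _ _ _) ge)) => //.
  by under [leRHS]eq_integral do rewrite /= mulr1.
by rewrite [RHS]splitr !div1r.
Qed.

End L2_means.

Section uncorrelated.
Context {R : realType} {dO d1 d2 : measure_display}.
Context {Om : measurableType dO} {T1 : measurableType d1} {T2 : measurableType d2}.
Variables (Pr : probability Om R).
Local Open Scope ereal_scope.

(** Square integrability of both factors makes the product integrable, so Fubini's theorem applies,
    and the inner integral over the centred factor [h] vanishes. *)
Lemma indep_mul_mean0 (S1 : {mfun Om >-> T1}) (S2 : {mfun Om >-> T2})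
    (f : T1 -> R) (h : T2 -> R) :
  (forall A B, measurable A -> measurable B ->
    Pr (S1 @^-1` A `&` S2 @^-1` B) = Pr (S1 @^-1` A) * Pr (S2 @^-1` B)) ->
  measurable_fun setT f -> measurable_fun setT h ->
  f \o S1 \in Lfun Pr 2%:E -> h \o S2 \in Lfun Pr 2%:E ->
  \int[Pr]_w (h (S2 w))%:E = 0 ->
  \int[Pr]_w (f (S1 w) * h (S2 w))%:E = 0.
Proof.
move=> SI mf mh f2 h2 h0.
have mS : measurable_fun setT (fun w => (S1 w, S2 w)) by exact: measurable_fun_pair.
pose S := mfun_Sub (mem_set mS).
pose F (z : T1 * T2) := (f z.1 * h z.2)%:E.
have mF : measurable_fun setT F.
  apply/measurable_EFinP; apply: measurable_funM.
  - exact: (measurableT_comp mf measurable_fst).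
  - exact: (measurableT_comp mh measurable_snd).
have iFS : Pr.-integrable setT (F \o S).
  by have := Lfun2_mul_Lfun1 f2 h2; move/Lfun1_integrable.
have h2S : (distribution Pr S2).-integrable setT (EFin \o h).
  apply: integrable_pushforward => //; first exact/measurable_EFinP.
  apply/Lfun1_integrable; apply: Lfun_subset12 h2.
  by rewrite fin_num_measure.
have h0' : \int[distribution Pr S2]_y (h y)%:E = 0.
  rewrite -h0 integral_distribution//; first exact/measurable_EFinP.
  by apply/Lfun1_integrable; apply: Lfun_subset12 h2; rewrite fin_num_measure.
transitivity (\int[distribution Pr S]_z F z).
  by rewrite integral_distribution.
have SE A : measurable A -> (distribution Pr S1 \x distribution Pr S2) A = distribution Pr S A.
  by move=> mA; rewrite joint_distribution.
rewrite (eq_measure_integral (distribution Pr S1 \x distribution Pr S2)); last first.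
  by move=> A mA _; exact/esym/SE.
rewrite -integral12_prod_meas1.
  rewrite [X in \int[_]_x X x](_ : _ = cst 0).
    by rewrite integral_cst// mul0e.
  apply/funext => x; rewrite /fubini_F /F/=.
  under eq_integral do rewrite EFinM.
  rewrite integralZl//.
  by rewrite h0' mule0.
apply/integrableP; split => //.
rewrite (eq_measure_integral (distribution Pr S)); last first.
  by move=> A mA _; exact: SE.
have /integrableP[_] : (distribution Pr S).-integrable setT F.
  exact: integrable_pushforward.
exact.
Qed.

End uncorrelated.

Section tightness.
Context {R : realType} {dO : measure_display} {Om : measurableType dO}.
Variable Pr : probability Om R.
Local Open Scope ereal_scope.

Lemma OP_sqr (Y : nat -> Om -> R) (K : R) : (forall n, measurable_fun setT (Y n)) ->
  (forall n, \int[Pr]_w (Y n w ^+ 2)%:E <= K%:E) -> OP Pr Y.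
Proof.
move=> mY YK; split=> // c c0.
(* Chebyshev's inequality needs [K <= M ^+ 2 * c]. This choice gives both [1 <= M] and
   [|K| + 1 <= M * c], which suffices and avoids a square root. *)
have M0 : (0 < (`|K| + 1) / c + 1)%R by rewrite ltr_pwDr// divr_ge0// ?addr_ge0// ltW.
exists ((`|K| + 1) / c + 1)%R => //; apply: nearW => n.
set M := ((`|K| + 1) / c + 1)%R.
have mM : measurable [set w | (M < `|Y n w|)%R] by exact: measurable_tail.
rewrite -(@lee_pmul2l _ (M ^+ 2)%:E) ?fin_numE// ?lte_fin ?exprn_gt0//.
apply: (@le_trans _ _ K%:E); last first.
  have Mc : (M * c = `|K| + 1 + c)%R by rewrite mulrDl mul1r divfK// gt_eqF.
  have M1 : (1 <= M)%R by rewrite lerDr divr_ge0// ?addr_ge0// ltW.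
  have := ler_norm K; have := normr_ge0 K.
  rewrite lee_fin expr2 -mulrA Mc => ? ?; apply: le_trans (ler_peMl _ M1); lra.
apply: le_trans (YK n).
have := @markov _ _ _ Pr (mfun_Sub (mem_set (mY n))) (fun x => x ^+ 2)%R M M0 _ _ _.
rewrite unlock /= => H; apply: (le_trans _ (le_trans (H _ _ _) _)).
- rewrite lee_pmul2l ?fin_numE// ?lte_fin ?exprn_gt0//.
  apply: le_measure; rewrite ?inE//.
    rewrite -[X in measurable X]setTI; apply: emeasurable_fun_c_infty => //.
    by apply/measurable_EFinP; exact: measurableT_comp.
  by move=> w /= /ltW; rewrite lee_fin.
- exact: exprn_measurable.
- by move=> r _; exact: sqr_ge0.
- by move=> x y; rewrite !nnegrE => x0 y0; rewrite ler_sqr.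
- by under eq_integral do rewrite /= real_normK ?num_real//.
Qed.

End tightness.

Section iid_sums.
Context {R : realType} {dO d : measure_display}.
Context {Om : measurableType dO} {T : measurableType d}.
Variables (Pr : probability Om R) (Q : probability T R) (X : nat -> Om -> T).
Hypothesis X_iid : iid Pr Q X.
Local Open Scope ereal_scope.

Lemma iid_integral_ge0 i (f : T -> \bar R) : measurable_fun setT f ->
  (forall x, 0 <= f x) -> \int[Pr]_w f (X i w) = \int[Q]_x f x.
Proof.
move=> mf f0; case: X_iid => mX XQ _.
pose Xi : {mfun Om >-> T} := mfun_Sub (mem_set (mX i)).
rewrite (_ : (fun w => f (X i w)) = f \o Xi)// -ge0_integral_distribution//.
by apply: eq_measure_integral => A mA _; exact: XQ.
Qed.

Lemma iid_integral i (f : T -> R) : Q.-integrable setT (EFin \o f) ->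
  \int[Pr]_w (f (X i w))%:E = \int[Q]_x (f x)%:E.
Proof.
move=> /integrableP[mf fi]; case: X_iid => mX XQ _.
pose Xi : {mfun Om >-> T} := mfun_Sub (mem_set (mX i)).
transitivity (\int[distribution Pr Xi]_y (f y)%:E); last first.
  by apply: eq_measure_integral => A mA _; exact: XQ.
rewrite integral_distribution//.
apply/integrableP; split; first exact: measurableT_comp.
rewrite (iid_integral_ge0 i (f := fun x => `|(f x)%:E|))//.
exact: measurableT_comp.
Qed.

Lemma iid_L2 i (g : T -> R) : L2 Q g -> (fun w => g (X i w)) \in Lfun Pr 2%:E.
Proof.
case/Lfun2P => mg g2; apply/Lfun2P; case: (X_iid) => mX _ _.
split; first exact: (measurableT_comp mg).
rewrite (iid_integral_ge0 i (f := fun x => ((g x) ^+ 2)%:E))//.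
- by apply/measurable_EFinP; exact: measurable_funX.
- by move=> x; rewrite lee_fin sqr_ge0.
Qed.

Lemma measurable_sample_sum (g : T -> R) n : measurable_fun setT g ->
  measurable_fun setT (fun x : n.-tuple T => \sum_(i < n) g (tnth x i))%R.
Proof.
move=> mg; apply: measurable_sum => i.
exact: (measurableT_comp mg (measurable_tnth i)).
Qed.

(** Square integrability of the partial sum is part of the induction because the cross term with the
    next observation is controlled through it. *)
Lemma iid_sum_variance (g : T -> R) n : L20 Q g ->
  (fun w => \sum_(i < n) g (X i w))%R \in Lfun Pr 2%:E /\
  \int[Pr]_w ((\sum_(i < n) g (X i w)) ^+ 2)%:E
  = (n%:R)%:E * \int[Q]_x ((g x) ^+ 2)%:E.
Proof.
move=> [g2 g0]; have /Lfun2P[mg gv] := g2.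
have gi : Q.-integrable setT (EFin \o g).
  by apply/Lfun1_integrable; apply: Lfun_subset12 g2; rewrite fin_num_measure.
have {}g0 : \int[Q]_x (g x)%:E = 0.
  by rewrite -[LHS]fineK ?integrable_fin_num//; congr EFin.
elim: n => [|n [IH1 IH2]].
  split.
    rewrite (_ : (fun w => _) = cst 0%R) ?Lfun_cst//.
    by apply/funext => w; rewrite big_ord0.
  rewrite mul0e; under eq_integral do rewrite big_ord0 expr0n/=.
  exact: integral0.
have gn2 := iid_L2 n g2.
have Sg0 : \int[Pr]_w ((\sum_(i < n) g (X i w)) * g (X n w))%:E = 0.
  (* The partial sum is a function of the first block of length [n], and the next observation is a
     block of length one, so block independence makes them uncorrelated. *)
  have mS a m : measurable_fun setT (sample X a m) by exact: (measurable_sample X_iid).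
  pose S1 : {mfun Om >-> n.-tuple T} := mfun_Sub (mem_set (@mS 0%N n)).
  pose S2 : {mfun Om >-> 1.-tuple T} := mfun_Sub (mem_set (@mS n 1%N)).
  pose F (x : n.-tuple T) := (\sum_(i < n) g (tnth x i))%R.
  pose h (x : 1.-tuple T) := g (tnth x ord0).
  have FE w : (\sum_(i < n) g (X i w) = F (S1 w))%R.
    by apply: eq_bigr => i _; rewrite tnth_mktuple.
  have hE w : g (X n w) = h (S2 w) by rewrite /h tnth_mktuple addn0.
  under eq_integral do rewrite FE hE.
  apply: indep_mul_mean0.
  - by move=> A B mA mB; apply: (sample_indep X_iid (a := 0) (b := n)); rewrite ?add0n ?leqnn.
  - exact: measurable_sample_sum.
  - exact: (measurableT_comp mg (measurable_tnth _)).
  - by move: IH1; rewrite (_ : (fun w => _) = F \o S1)//; apply/funext.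
  - by move: gn2; rewrite (_ : (fun w => _) = h \o S2)//; apply/funext.
  - by under eq_integral do rewrite -hE; rewrite iid_integral.
have SE w : (\sum_(i < n.+1) g (X i w) = \sum_(i < n) g (X i w) + g (X n w))%R.
  by rewrite big_ord_recr.
split.
  rewrite (_ : (fun w => _) =
      ((fun w => \sum_(i < n) g (X i w)) + (fun w => g (X n w))))%R; last first.
    by apply/funext => w; rewrite SE.
  by apply: (Lfun_addr_closed Pr (lee1n 2)).2.
have iS := Lfun2_integrable_sqr IH1; have ig := Lfun2_integrable_sqr gn2.
have /Lfun1_integrable iSg := Lfun2_mul_Lfun1 IH1 gn2.
have i2Sg : Pr.-integrable setT
    (fun w => 2%:E * ((\sum_(i < n) g (X i w)) * g (X n w))%:E).
  exact: (integrableZl measurableT 2%R iSg).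
rewrite (eq_integral (fun w => ((\sum_(i < n) g (X i w)) ^+ 2)%:E +
    2%:E * ((\sum_(i < n) g (X i w)) * g (X n w))%:E + (g (X n w) ^+ 2)%:E)); last first.
  by move=> w _; rewrite SE sqrrD -mulr_natl !EFinD EFinM.
rewrite integralD//; last exact: integrableD.
rewrite integralD//.
rewrite integralZl// Sg0 mule0 adde0 IH2.
rewrite (iid_integral_ge0 n (f := fun x => ((g x) ^+ 2)%:E)); last 2 first.
- by apply/measurable_EFinP; exact: measurable_funX.
- by move=> x; rewrite lee_fin sqr_ge0.
rewrite -[in RHS]natr1 EFinD ge0_muleDl ?lee_fin ?ler0n//.
by rewrite mul1e.
Qed.

Lemma iid_sum_OP (g : T -> R) : L20 Q g ->
  OP Pr (fun n w => (Num.sqrt n%:R)^-1 * \sum_(i < n) g (X i w))%R.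
Proof.
move=> g2; have /Lfun2P[mg gv] := g2.1.
have mS n : measurable_fun setT (fun w => \sum_(i < n) g (X i w))%R.
  by have [/Lfun2P[]] := iid_sum_variance n g2.
apply: (@OP_sqr _ _ _ _ _ (fine (\int[Q]_x ((g x) ^+ 2)%:E))).
  by move=> n; exact: measurable_funM.
move=> n; have v0 : 0 <= \int[Q]_x ((g x) ^+ 2)%:E.
  by apply: integral_ge0 => x _; rewrite lee_fin sqr_ge0.
rewrite fineK ?ge0_fin_numE//.
under eq_integral do rewrite exprMn EFinM.
rewrite ge0_integralZl// ?lee_fin ?sqr_ge0//; last 2 first.
- by apply/measurable_EFinP; exact: measurable_funX.
- by move=> w _; rewrite lee_fin sqr_ge0.
rewrite (iid_sum_variance n g2).2 muleA -EFinM exprVn sqr_sqrtr ?ler0n//.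
have [->|n0] := eqVneq n 0%N; first by rewrite mulr0 mul0e.
by rewrite mulVf ?mul1e// pnatr_eq0.
Qed.

End iid_sums.

(** * Column vectors and joint measurability in the parameter *)

Lemma mx_coord_le {R : realType} {m n : nat} (A : 'M[R]_(m, n)) i j : `|A i j| <= `|A|.
Proof.
rewrite [leRHS]mx_normrE; exact: (le_bigmax _ (fun ij => `|A ij.1 ij.2|) (i, j)).
Qed.

Section column_vectors.
Context {R : realType} {k : nat}.
Implicit Types v : 'cV[R]_k.

Lemma cV_norm_le v (M : R) : 0 <= M -> (forall j, `|v j 0| <= M) -> `|v| <= M.
Proof.
move=> M0 vM; rewrite [leLHS]mx_normrE; apply/bigmax_leP; split => // -[i j] _ /=.
by rewrite ord1.
Qed.

Lemma cV_norm_le_sum v : `|v| <= \sum_(j < k) `|v j 0|.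
Proof.
apply: cV_norm_le => [|j]; first exact: sumr_ge0.
by rewrite (bigD1 j)//= lerDl sumr_ge0.
Qed.

Lemma col_of_tupleK v : col_of_tuple [tuple v i 0 | i < k] = v.
Proof. by apply/colP => i; rewrite mxE tnth_mktuple. Qed.

(* An open set is the union of the boxes with rational centres and radii 1/(n+1)
   that it contains. *)
Lemma open_cV_measurable (U : set 'cV[R]_k) : open U ->
  measurable [set v : k.-tuple R | U (col_of_tuple v)].
Proof.
move=> oU.
pose q (p : k.-tuple rat * nat) : 'cV[R]_k := \col_i ratr (tnth p.1 i).
pose box (p : k.-tuple rat * nat) : set (k.-tuple R) :=
  [set v | (forall u, `|u - q p| <= p.2.+1%:R^-1 -> U u) /\
           forall i, `|tnth v i - q p i 0| <= p.2.+1%:R^-1].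
have -> : [set v : k.-tuple R | U (col_of_tuple v)] =
    \bigcup_(n in setT) (if unpickle n is Some p then box p else set0).
  apply/seteqP; split => [v /= Uv|v [n _]]; last first.
    case: unpickle => // p [pU vp] /=; apply: pU; apply: cV_norm_le => // j.
    by rewrite mxE [col_of_tuple v j 0]mxE mxE; exact: vp.
  have /nbhs_ballP[e /= e0 eU] : nbhs (col_of_tuple v) U by exact: open_nbhs_nbhs.
  (* Half of [e] is taken because a point of the rational box is compared with [v] through the
     centre of the box, at the cost of two radii. *)
  have [n [s [sE s0 se]]] : exists n s, [/\ n.+1%:R^-1 = s :> R, 0 < s & s < e / 2].
    have [n _ /(_ n (leqnn n)) ?] :=
      near_infty_natSinv_lt (PosNum (divr_gt0 e0 (ltr0Sn R 1))).
    by exists n, n.+1%:R^-1; split => //; rewrite invr_gt0 ltr0n.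
  have /choice[r rP] i : exists r : rat, `|tnth v i - ratr r| < s.
    have [|r] := @rat_in_itvoo R (tnth v i - s) (tnth v i + s); first lra.
    by rewrite in_itv/= => /andP[? ?]; exists r; rewrite ltr_norml; lra.
  exists (pickle ([tuple r i | i < k], n)) => //; rewrite pickleK; split => /=.
    move=> u; rewrite sE => uq; apply: eU; rewrite -ball_normE/=.
    apply: (@le_lt_trans _ _ (s + s)); last lra.
    apply: cV_norm_le => [|j]; first lra.
    rewrite -(subrK (q ([tuple r i | i < k], n)) (col_of_tuple v)) -addrA mxE.
    apply: (le_trans (ler_normD _ _)); apply: lerD.
      by rewrite mxE [col_of_tuple v _ _]mxE !mxE tnth_mktuple ltW.
    by rewrite (le_trans (mx_coord_le _ _ _))// distrC.
  by move=> i; rewrite mxE tnth_mktuple sE ltW.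
apply: bigcupT_measurable => n; case: unpickle => // p.
have [pU|pU] := pselect (forall u, `|u - q p| <= p.2.+1%:R^-1 -> U u); last first.
  by rewrite (_ : box p = set0)//; rewrite -subset0 => v [/pU].
rewrite (_ : box p = rectangle k
    (fun i => if insub i is Some j then [set x | `|x - q p j 0| <= p.2.+1%:R^-1] else setT)).
  apply: measurable_rectangle => i; case: insub => // j.
  rewrite (_ : [set x | _] =
      `[q p j 0 - p.2.+1%:R^-1, q p j 0 + p.2.+1%:R^-1]%classic).
    exact: measurable_itv.
  by apply/seteqP; split => x /=; rewrite in_itv/= ler_distl.
apply/seteqP; split => [v [_ vp] i|v vp]; first by rewrite valK /=; exact: vp.
by split => // i; have := vp i; rewrite valK.
Qed.

End column_vectors.

Section joint_measurability.
Context {R : realType} {k : nat} {d dO : measure_display}.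
Context {T : measurableType d} {Om : measurableType dO}.

(** This is how a random parameter is substituted. Openness of [D] ensures that the domain on which
    [f] is jointly measurable is itself a measurable set. *)
Lemma jointly_measurable_comp (D : set 'cV[R]_k) (f : T -> 'cV[R]_k -> R)
    (g : Om -> T) (h : Om -> 'cV[R]_k) :
  open D -> jointly_measurable D f -> measurable_fun setT g ->
  (forall i, measurable_fun setT (fun w => h w i 0)) -> (forall w, D (h w)) ->
  measurable_fun setT (fun w => f (g w) (h w)).
Proof.
move=> oD mf mg mh Dh.
pose G w := (g w, [tuple h w i 0 | i < k]).
have mh' : measurable_fun setT (fun w => [tuple h w i 0 | i < k]).
  apply/measurable_fun_tnthP => i; rewrite (_ : _ \o _ = fun w => h w i 0)//.
  by apply/funext => w /=; rewrite tnth_mktuple.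
have mG : measurable_fun setT G by exact: measurable_fun_pair.
rewrite (_ : (fun w => _) = (fun z => f z.1 (col_of_tuple z.2)) \o G); last first.
  by apply/funext => w /=; rewrite col_of_tupleK.
apply: (measurable_comp _ _ mf mG).
  rewrite (_ : [set z | _] = setT `*` [set v : k.-tuple R | D (col_of_tuple v)]).
    by apply: measurableX => //; exact: open_cV_measurable.
  by apply/seteqP; split => // z [].
by move=> _ [w _ <-] /=; rewrite col_of_tupleK.
Qed.

End joint_measurability.

Lemma jointly_measurable_section {R : realType} {k : nat} {d : measure_display}
    {T : measurableType d} (D : set 'cV[R]_k) (f : T -> 'cV[R]_k -> R) th :
  open D -> jointly_measurable D f -> D th -> measurable_fun setT (f ^~ th).
Proof.
move=> oD mf Dth.
by apply: (jointly_measurable_comp (g := id) (h := fun=> th) oD mf).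
Qed.

(** * Centredness of the efficient score *)

Section L20_space.
Context {R : realType} {d : measure_display} {T : measurableType d}.
Variable Q : probability T R.

Lemma L2_integrable (f : T -> R) : L2 Q f -> Q.-integrable setT (EFin \o f).
Proof.
by move=> f2; apply/Lfun1_integrable; apply: Lfun_subset12 f2; rewrite fin_num_measure.
Qed.

Lemma L20_0 : L20 Q (fun=> 0).
Proof. by split; [exact: (Lfun_cst Q)|rewrite /Rintegral integral0]. Qed.

Lemma L20D (a : R) (f g : T -> R) : L20 Q f -> L20 Q g ->
  L20 Q (fun x => a * f x + g x).
Proof.
move=> [f2 f0] [g2 g0].
have af2 : L2 Q (fun x => a * f x).
  rewrite /L2/= (_ : (fun x => _) = a \o* f); last by apply/funext => x /=; rewrite mulrC.
  by apply: Lfun_scale => //; rewrite ler1n.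
split; first exact: (Lfun_addr_closed Q (lee1n 2)).2.
rewrite RintegralD//; [|exact: L2_integrable..].
by rewrite RintegralZl//; [rewrite f0 g0 mulr0 addr0|exact: L2_integrable].
Qed.

Lemma L20_sum n (a : 'I_n -> R) (f : 'I_n -> T -> R) : (forall i, L20 Q (f i)) ->
  L20 Q (fun x => \sum_(i < n) a i * f i x).
Proof.
elim: n a f => [|n IH] a f f2.
  rewrite (_ : (fun x => _) = fun=> 0); first exact: L20_0.
  by apply/funext => x; rewrite big_ord0.
rewrite (_ : (fun x => _) = fun x => a ord0 * f ord0 x +
    \sum_(i < n) a (lift ord0 i) * f (lift ord0 i) x).
  by apply: L20D => //; apply: IH => i.
by apply/funext => x; rewrite big_ord_recl.
Qed.

Lemma L20_lin_span (S : set (T -> R)) : S `<=` L20 Q -> lin_span S `<=` L20 Q.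
Proof.
move=> SL _ [n [a [g [Sg ->]]]].
rewrite (_ : \sum_(i < n) _ = fun x => \sum_(i < n) a i * g i x).
  by apply: L20_sum => i; exact: SL.
by apply/funext => x; rewrite fct_sumE.
Qed.

Lemma L20_closed_span (S : set (T -> R)) : S `<=` L20 Q ->
  L2_closed_span Q S `<=` L20 Q.
Proof.
move=> SL f [f2 fS]; split=> //; apply: L2_mean0_limit => // e /fS[g gS ge].
by exists g => //; exact: L20_lin_span gS.
Qed.

Lemma L20_ae (f g : T -> R) : L20 Q f -> measurable_fun setT g ->
  {ae Q, forall x, g x = f x} -> L20 Q g.
Proof.
move=> [f2 f0] mg gf; have /Lfun2P[mf fi] := f2.
split.
  apply/Lfun2P; split=> //.
  rewrite (ae_eq_integral (fun x => ((f x) ^+ 2)%:E))//.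
  - by apply/measurable_EFinP; exact: measurable_funX.
  - by apply/measurable_EFinP; exact: measurable_funX.
  - by apply: filterS gf => x /= -> _.
rewrite -f0 /Rintegral; congr fine; apply: ae_eq_integral => //.
- exact/measurable_EFinP.
- exact/measurable_EFinP.
- by apply: filterS gf => x /= -> _.
Qed.

End L20_space.

Section efficient_score.
Context {R : realType} {k : nat} {d : measure_display} {T : measurableType d}.
Context {H : normedModType R}.
Variables (Theta : set 'cV[R]_k) (P : 'cV[R]_k -> H -> probability T R).
Variables (C : set (R -> H)) (th : 'cV[R]_k) (G : H).
Variables (l1 : T -> 'cV[R]_k) (l2 : H -> T -> R) (ls : T -> 'cV[R]_k).
Hypothesis hellinger : hellinger_derivative Theta P C th G (total_score l1 l2).
Hypothesis ls_eff : is_efficient_score (P th G) C l1 l2 ls.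

(** The Hellinger derivative takes values in centred functions, and centring passes to linear spans
    and to L_2 limits, hence to the projection that is subtracted. *)
Lemma efficient_score_L20 i : L20 (P th G) (fun x => ls x i 0).
Proof.
case: hellinger => tot _ _ _.
have t0 : tangent_space C 0.
  by apply: subset_closure; exists 0%N, (fun=> 0), (fun=> 0); split => [[]//|]; rewrite big_ord0.
have tp p : C p -> tangent_space C (tangent p).
  move=> Cp; apply: subset_closure; exists 1%N, (fun=> 1), (fun=> tangent p).
  by split; [move=> _; left; exists p|rewrite big_ord1 scale1r].
have l2_L20 g : tangent_space C g -> L20 (P th G) (l2 g).
  move=> /(tot 0); rewrite (_ : total_score _ _ _ _ = l2 g)//.
  by apply/funext => x; rewrite /total_score mulmx0 mxE add0r.
(* The total score in direction [delta_mx i 0] with zero nuisance tangent is this coordinate plus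
   [l2 0]. Linearity is known only almost everywhere, so [l2 0] is subtracted rather than set to
   zero pointwise. *)
have l1_L20 : L20 (P th G) (fun x => l1 x i 0).
  have := L20D (- 1) (l2_L20 _ t0) (tot (delta_mx i 0) _ t0).
  rewrite (_ : (fun x => _) = fun x => l1 x i 0)//; apply/funext => x.
  rewrite /total_score mxE (bigD1 i)//= big1 => [|j ji].
    by rewrite !mxE !eqxx mulr1; ring.
  by rewrite !mxE (negbTE ji) mulr0.
have [mls [pf [pfV _] pfE]] := ls_eff i.
have pf_L20 : L20 (P th G) pf.
  by apply: L20_closed_span pfV => _ [p Cp <-]; apply/l2_L20/tp.
apply: L20_ae mls pfE; have := L20D (- 1) pf_L20 l1_L20.
by rewrite (_ : (fun x => _) = fun x => l1 x i 0 - pf x)//; apply/funext => x; ring.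
Qed.

End efficient_score.

(** * Uniformity over local neighbourhoods and the plug-in step *)

Lemma near_infty_comp (m : nat -> nat) (P : nat -> Prop) : m @ \oo --> \oo ->
  (\forall n \near \oo, P n) -> \forall n \near \oo, P (m n).
Proof. by move=> minf; exact: minf. Qed.

Section local_uniformity.
Context {R : realType} {k : nat}.
Variables (Theta : set 'cV[R]_k) (th0 : 'cV[R]_k).
Hypotheses (Theta_open : open Theta) (Theta_th0 : Theta th0).

Lemma sqrt_nat_infty (M : R) : \forall n \near \oo, M < Num.sqrt n%:R.
Proof.
near=> n; have : `|M| ^+ 2 < n%:R.
  near: n; exact: nbhs_infty_gtr.
move=> Mn; apply: (le_lt_trans (ler_norm M)).
by rewrite -ltr_sqr ?nnegrE ?sqrtr_ge0// sqr_sqrtr// ltW // (le_lt_trans _ Mn)// sqr_ge0.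
Unshelve. all: by end_near. Qed.

(** The neighbourhoods shrink like the inverse root of [n] inside an open set. This serves values of
    the estimator, which are not assumed to belong to [Theta]. *)
Lemma local_in_Theta (M : R) : \forall n \near \oo, forall th,
  `|Num.sqrt n%:R *: (th - th0)| <= M -> Theta th.
Proof.
have /nbhs_ballP[e /= e0 eT] : nbhs th0 Theta by exact: open_nbhs_nbhs.
near=> n => th; rewrite normrZ ger0_norm ?sqrtr_ge0// => thM.
apply: eT; rewrite -ball_normE/= distrC.
have nM : (`|M| + 1) / e < Num.sqrt n%:R by near: n; exact: sqrt_nat_infty.
have n0 : 0 < Num.sqrt n%:R :> R.
  by apply: lt_trans nM; rewrite divr_gt0// ltr_wpDl.
rewrite -(ltr_pM2l n0); apply: (le_lt_trans thM).
move: nM; rewrite ltr_pdivrMr// => nM; apply: le_lt_trans nM.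
by have := ler_norm M; lra.
Unshelve. all: by end_near. Qed.

(* Choosing a near-worst parameter for each [n] turns convergence along every local
   sequence into convergence uniform over local neighbourhoods. *)
Lemma local_uniform (F : nat -> 'cV[R]_k -> \bar R) (M : R) (c : \bar R) :
  (forall th, root_n_local Theta th0 th -> \forall n \near \oo, (F n (th n) <= c)%E) ->
  \forall n \near \oo, forall th, `|Num.sqrt n%:R *: (th - th0)| <= M ->
    (F n th <= c)%E.
Proof.
move=> Fc.
pose bad n th := [/\ Theta th, `|Num.sqrt n%:R *: (th - th0)| <= M & ~ (F n th <= c)%E].
(* Where no bad parameter exists, [th0] is a harmless default: it lies in [Theta] at distance zero,
   so the chosen sequence remains root-n local. *)
have /choice[th thP] n : exists th, bad n th \/ th = th0 /\ ~ exists th, bad n th.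
  have [[th bth]|nb] := pselect (exists th, bad n th); first by exists th; left.
  by exists th0; right.
have loc : root_n_local Theta th0 th.
  split=> [n|]; first by have [[]|[-> _]] := thP n.
  exists `|M| => n; have [[_ h _]|[-> _]] := thP n; last by rewrite subrr scaler0 normr0.
  by rewrite (le_trans h)// ler_norm.
near=> n => th' thM.
have thT : Theta th'.
  by move: th' thM; near: n; exact: local_in_Theta.
apply: contrapT => nF; have [[_ _ nF']|[_ nb]] := thP n; last by apply: nb; exists th'.
by apply: nF'; near: n; exact: Fc.
Unshelve. all: by end_near. Qed.

End local_uniformity.

Section block_statistics.
Context {R : realType} {dO d : measure_display}.
Context {Om : measurableType dO} {T : measurableType d}.
Variables (Pr : probability Om R) (Q : probability T R) (X : nat -> Om -> T).
Hypothesis X_iid : iid Pr Q X.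

Lemma block_prob a m (A : set (m.-tuple T)) : measurable A ->
  Pr [set w | A (sample X a m w)] = Pr [set w | A (sample X 0 m w)].
Proof. exact: (sample_distr X_iid). Qed.

Variable phi : forall m, m.-tuple T -> R.
Hypothesis mphi : forall m, measurable_fun setT (@phi m).
Variables (a m : nat -> nat).
Hypothesis m_infty : m @ \oo --> \oo.

Let mblock n : measurable_fun setT (fun w => phi (sample X (a n) (m n) w)).
Proof. exact: (measurableT_comp (@mphi _) (@measurable_sample _ _ _ _ _ _ _ _ X_iid _ _)). Qed.

(** A block of length [m n] has the law of the first [m n] observations wherever it starts, so its
    offset is irrelevant and only the growth of [m] counts. *)
Lemma oP_block : oP Pr (fun n w => phi (sample X 0 n w)) ->
  oP Pr (fun n w => phi (sample X (a n) (m n) w)).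
Proof.
move=> [_ h]; split=> // e c e0 c0; have := near_infty_comp m_infty (h e c e0 c0).
apply: filterS => n /=.
rewrite (@block_prob (a n) (m n) [set x | e < `|phi x|])//.
exact: (measurable_tail e (@mphi (m n))).
Qed.

Lemma OP_block : OP Pr (fun n w => phi (sample X 0 n w)) ->
  OP Pr (fun n w => phi (sample X (a n) (m n) w)).
Proof.
move=> [_ h]; split=> // c /h[M M0 hM]; exists M => //; have := near_infty_comp m_infty hM.
apply: filterS => n /=.
rewrite (@block_prob (a n) (m n) [set x | M < `|phi x|])//.
exact: (measurable_tail M (@mphi (m n))).
Qed.

End block_statistics.

Section plug_in.
Context {R : realType} {k : nat} {dO d : measure_display}.
Context {Om : measurableType dO} {T : measurableType d}.
Variables (Pr : probability Om R) (Q : probability T R) (X : nat -> Om -> T).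
Hypothesis X_iid : iid Pr Q X.
Variables (Theta : set 'cV[R]_k) (th0 : 'cV[R]_k).
Hypotheses (Theta_open : open Theta) (Theta_th0 : Theta th0).
Variable f : forall m, m.-tuple T -> 'cV[R]_k -> R.
Hypothesis mf : forall m, jointly_measurable setT (@f m).
Hypothesis f_oP : forall th, root_n_local Theta th0 th ->
  oP Pr (fun n w => f (sample X 0 n w) (th n)).
Variables (t : forall n, n.-tuple T -> 'cV[R]_k) (a l b m : nat -> nat).
Hypothesis mt : forall n j, measurable_fun setT (fun x : n.-tuple T => t x j 0).
Hypothesis l_infty : l @ \oo --> \oo.
Hypothesis disj : \forall n \near \oo, (a n + l n <= b n)%N || (b n + m n <= a n)%N.
Hypothesis t_OP : forall j, OP Pr (fun n w =>
  Num.sqrt (l n)%:R * (t (sample X (b n) (m n) w) - th0) j 0).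

Let mS c n : measurable_fun setT (sample X c n).
Proof. exact: (measurable_sample X_iid). Qed.

Lemma oP_plug_in : oP Pr (fun n w =>
  f (sample X (a n) (l n) w) (t (sample X (b n) (m n) w))).
Proof.
(* The sum of coordinates dominates the norm, while its measurability and tightness follow
   coordinate by coordinate. The scale is the size of the block on which [f] is evaluated, not of
   the block that yields the estimator. *)
pose N l y := \sum_(j < k) `|Num.sqrt l%:R * ((y : 'cV[R]_k) - th0) j 0|.
have N_OP : OP Pr (fun n w => N (l n) (t (sample X (b n) (m n) w))).
  by apply: OP_sum => j; exact/OP_norm/t_OP.
have mft : forall n, measurable_fun setT
    (fun z : (l n).-tuple T * (m n).-tuple T => f z.1 (t z.2)).
  move=> n; apply: (jointly_measurable_comp openT (@mf (l n)) measurable_fst) => // j.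
  exact: (measurableT_comp (@mt _ j) measurable_snd).
have mN n : measurable_fun setT (fun y : (m n).-tuple T => N (l n) (t y)).
  apply: measurable_sum => j; apply: measurableT_comp => //.
  apply: measurable_funM => //; under eq_fun do rewrite !mxE.
  exact: (measurable_funB (@mt (m n) j) (measurable_cst (th0 j 0))).
split=> [n|e c e0 c0].
  exact: (measurableT_comp (mft n) (measurable_fun_pair (@mS _ _) (@mS _ _))).
have c20 : 0 < c / 2 by rewrite divr_gt0.
have [M M0 hM] := N_OP.2 _ c20.
have unif : \forall n \near \oo, forall th, `|Num.sqrt n%:R *: (th - th0)| <= M ->
    (Pr [set w | (e < `|f (sample X 0 n w) th|)%R] <= (c / 2)%:E)%E.
  by apply: (local_uniform Theta_open Theta_th0) => th loc; apply: (f_oP loc).2.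
near=> n.
have disjn : (a n + l n <= b n)%N || (b n + m n <= a n)%N by near: n.
(* The truncation is built into the event since [sample_section_bound] asks for a bound at every
   [y]: outside the neighbourhood the section is empty, inside it the uniform bound applies. *)
pose A : set ((l n).-tuple T * (m n).-tuple T) :=
  [set z | e < `|f z.1 (t z.2)| /\ N (l n) (t z.2) <= M].
have mA : measurable A.
  rewrite (_ : A = [set z | e < `|f z.1 (t z.2)|] `&`
                   ~` (snd @^-1` [set y : (m n).-tuple T | M < `|N (l n) (t y)|])).
    apply: measurableI; first exact: (measurable_tail e (mft n)).
    apply: measurableC; rewrite -[X in measurable X]setTI; apply: measurable_snd => //.
    exact: (measurable_tail M (mN n)).
  apply/seteqP; split => z [? h]; split => //=; move: h => /=.
    by rewrite ger0_norm ?sumr_ge0// ltNge => ->.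
  by move=> /negP; rewrite -leNgt ger0_norm ?sumr_ge0.
rewrite [c]splitr EFinD.
apply: (@prob_leU _ _ _ _ _ [set w | A (sample X (a n) (l n) w, sample X (b n) (m n) w)]
  [set w | M < `|N (l n) (t (sample X (b n) (m n) w))|]).
- apply: measurable_tail.
  exact: (measurableT_comp (mft n) (measurable_fun_pair (@mS _ _) (@mS _ _))).
- rewrite -[X in measurable X]setTI.
  exact: (measurable_fun_pair (@mS (a n) (l n)) (@mS (b n) (m n))).
- exact/measurable_tail/(measurableT_comp (mN n) (@mS _ _)).
- move=> w /= h; have [MN|MN] := ltP M `|N (l n) (t (sample X (b n) (m n) w))|.
    by right.
  by left; split => //; rewrite -[leLHS]ger0_norm ?sumr_ge0.
- apply: (sample_section_bound X_iid) => // y.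
  have [NM|NM] := leP (N (l n) (t y)) M; last first.
    rewrite (_ : _ @^-1` _ = set0) ?measure0 ?lee_fin 1?ltW//.
    by rewrite -subset0 => w [] /= _; rewrite leNgt NM.
  rewrite (_ : _ @^-1` _ = [set w | e < `|f (sample X (a n) (l n) w) (t y)|]); last first.
    by apply/seteqP; split => w /=; [case|].
  rewrite (block_prob X_iid (a n) (A := [set x | e < `|f x (t y)|])); last first.
    exact: (measurable_tail e
      (jointly_measurable_section (th := t y) openT (@mf (l n)) I)).
  have nt : `|Num.sqrt (l n)%:R *: (t y - th0)| <= M.
    apply: le_trans NM; apply: (le_trans (cV_norm_le_sum _)).
    by apply: ler_sum => j _; rewrite mxE.
  by move: (t y) nt; near: n; exact: (near_infty_comp l_infty unif).
- by near: n.
Unshelve. all: by end_near. Qed.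

End plug_in.

(** * Two asymptotically equal halves and their combined expansion *)

Section half_split.
Context {R : realType}.
Variable l : nat -> nat.
Hypothesis l_half : ((l n)%:R / n%:R : R) @[n --> \oo] --> (2^-1 : R).

Lemma half_split_dist (e : R) : 0 < e -> \forall n \near \oo,
  [/\ (0 < n)%N, (l n <= n)%N & `|(l n)%:R - (n - l n)%:R| <= e * n%:R :> R].
Proof.
move=> e0; pose e1 := Num.min e 1.
have e10 : 0 < e1 by rewrite lt_min e0 ltr01.
near=> n; have n0 : (0 < n)%N by near: n; exact: nbhs_infty_gt.
have N0 : 0 < n%:R :> R by rewrite ltr0n.
have : `|2^-1 - (l n)%:R / n%:R| <= e1 / 2 :> R.
  by near: n; move/cvgrPdist_le : l_half; apply; rewrite divr_gt0.
rewrite (_ : 2^-1 - _ = (n%:R / 2 - (l n)%:R) / n%:R); last by field; rewrite gt_eqF.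
rewrite normrM normfV (ger0_norm (ltW N0)) ler_pdivrMr// => h.
have e11 : e1 <= 1 by rewrite ge_min lexx orbT.
have e1e : e1 <= e by rewrite ge_min lexx.
have e1n : e1 * n%:R <= n%:R by rewrite ler_piMl// ltW.
have e1n' : e1 * n%:R <= e * n%:R by rewrite ler_pM2r.
move: h; rewrite mulrAC ler_norml => /andP[h1 h2].
have ln : (l n <= n)%N by rewrite -(ler_nat R); lra.
split => //; rewrite natrB// ler_norml; lra.
Unshelve. all: by end_near. Qed.

Lemma half_split_quarter : \forall n \near \oo,
  [/\ (0 < n)%N, (l n <= n)%N, n%:R <= 4 * (l n)%:R :> R & n%:R <= 4 * (n - l n)%:R :> R].
Proof.
near=> n; have [n0 ln h] : [/\ (0 < n)%N, (l n <= n)%N &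
    `|(l n)%:R - (n - l n)%:R| <= 2^-1 * n%:R :> R].
  by near: n; apply: half_split_dist; rewrite invr_gt0.
split=> //; move: h; rewrite natrB// ler_norml; lra.
Unshelve. all: by end_near. Qed.

Lemma half_split_infty : l @ \oo --> \oo /\ (fun n => n - l n)%N @ \oo --> \oo.
Proof.
split; apply/cvgnyPge => A; near=> n;
  have [_ _ ? ?] : [/\ (0 < n)%N, (l n <= n)%N, n%:R <= 4 * (l n)%:R :> R &
     n%:R <= 4 * (n - l n)%:R :> R] by near: n; exact: half_split_quarter.
all: have An : (4 * A <= n)%N by near: n; exact: nbhs_infty_ge.
all: by move: An; rewrite -(ler_nat R) natrM -(ler_nat R); lra.
Unshelve. all: by end_near. Qed.

End half_split.

Lemma sum_nat_split {R : realType} (F : nat -> R) l n : (l <= n)%N ->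
  \sum_(i < n) F i = \sum_(i < l) F i + \sum_(i < n - l) F (l + i)%N.
Proof.
move=> ln; have [m ->] : exists m, n = (l + m)%N by exists (n - l)%N; rewrite subnKC.
by rewrite addKn big_split_ord.
Qed.

(* Here [s], [t] and [r] stand for the square roots of the block sizes and of the
   sample size, and the remaining arguments for the sums over the two blocks. *)
Lemma split_identity {R : realType} (k : nat) (c t1 t2 g1 g2 : 'I_k -> R)
    (s t r b1 b2 p1 p2 : R) : s != 0 -> t != 0 -> r != 0 ->
  r * (s ^+ 2 / r ^+ 2 * b1 + t ^+ 2 / r ^+ 2 * b2) - r^-1 * (p1 + p2)
    - \sum_(j < k) c j * (r^-1 * (g1 j + g2 j)) =
  s / r * (s * b1 - s^-1 * p1 - \sum_(j < k) c j * (s * t2 j))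
  + t / r * (t * b2 - t^-1 * p2 - \sum_(j < k) c j * (t * t1 j))
  + \sum_(j < k) c j * (s ^+ 2 / (r * t) * (t * t2 j - t^-1 * g2 j)
      + (s ^+ 2 - t ^+ 2) / (r * t) * (t^-1 * g2 j)
      + t ^+ 2 / (r * s) * (s * t1 j - s^-1 * g1 j)
      + (t ^+ 2 - s ^+ 2) / (r * s) * (s^-1 * g1 j)).
Proof.
move=> s0 t0 r0.
(* The first block brings in [t2] with weight [s ^+ 2 / r]. Replacing [t * t2] by its linear part
   leaves [g2] with factor [s ^+ 2 / (r * t)] on [t^-1 * g2], where the target has
   [t ^+ 2 / (r * t)]; the difference is the imbalance term. The other block is symmetric. Working
   inside the sum lets [field] act coordinatewise. *)
have -> : \sum_(j < k) c j * (r^-1 * (g1 j + g2 j)) =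
    s / r * (\sum_(j < k) c j * (s * t2 j)) + t / r * (\sum_(j < k) c j * (t * t1 j))
    - \sum_(j < k) c j * (s ^+ 2 / (r * t) * (t * t2 j - t^-1 * g2 j)
      + (s ^+ 2 - t ^+ 2) / (r * t) * (t^-1 * g2 j)
      + t ^+ 2 / (r * s) * (s * t1 j - s^-1 * g1 j)
      + (t ^+ 2 - s ^+ 2) / (r * s) * (s^-1 * g1 j)).
  rewrite !mulr_sumr -big_split -sumrB; apply: eq_bigr => j _ /=; field.
  by rewrite s0 t0 r0.
by field; rewrite s0 r0 t0.
Qed.

Section split_linear.
Context {R : realType} {k : nat} {dO d : measure_display}.
Context {Om : measurableType dO} {T : measurableType d}.
Variables (Pr : probability Om R) (Q : probability T R) (X : nat -> Om -> T).
Hypothesis X_iid : iid Pr Q X.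
Variables (Theta : set 'cV[R]_k) (th0 : 'cV[R]_k).
Hypotheses (Theta_open : open Theta) (Theta_th0 : Theta th0).
Variables (t : forall n, n.-tuple T -> 'cV[R]_k) (g : T -> 'cV[R]_k).
Hypothesis mt : forall n j, measurable_fun setT (fun x : n.-tuple T => t x j 0).
Hypothesis g_L20 : forall j, L20 Q (fun x => g x j 0).
Hypothesis t_lin : forall j, oP Pr (fun n w =>
  Num.sqrt n%:R * (t (sample X 0 n w) - th0) j 0
  - (Num.sqrt n%:R)^-1 * \sum_(i < n) g (X i w) j 0).
Variables (v : forall n, n.-tuple T -> 'cV[R]_k -> R) (p : T -> R) (c : 'rV[R]_k).
Hypothesis mv : forall n, jointly_measurable setT (@v n).
Hypothesis mp : measurable_fun setT p.
Hypothesis v_lin : forall th, root_n_local Theta th0 th -> oP Pr (fun n w =>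
  Num.sqrt n%:R * v (sample X 0 n w) (th n)
  - (Num.sqrt n%:R)^-1 * \sum_(i < n) p (X i w)
  - (c *m (Num.sqrt n%:R *: (th n - th0))) 0 0).
Variable l : nat -> nat.
Hypothesis l_half : ((l n)%:R / n%:R : R) @[n --> \oo] --> (2^-1 : R).

Let mg j : measurable_fun setT (fun x => g x j 0).
Proof. by have [/Lfun2P[]] := g_L20 j. Qed.

Let mS a n : measurable_fun setT (sample X a n).
Proof. exact: (measurable_sample X_iid). Qed.

Let sampleE (F : T -> R) a n w :
  \sum_(i < n) F (tnth (sample X a n w) i) = \sum_(i < n) F (X (a + i)%N w).
Proof. by apply: eq_bigr => i _; rewrite tnth_mktuple. Qed.

Let t_err j n (x : n.-tuple T) : R := Num.sqrt n%:R * (t x - th0) j 0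
  - (Num.sqrt n%:R)^-1 * \sum_(i < n) g (tnth x i) j 0.

Let g_sum j n (x : n.-tuple T) : R :=
  (Num.sqrt n%:R)^-1 * \sum_(i < n) g (tnth x i) j 0.

(** The remainder in [v_lin] as a function of data and parameter. The product with [c] is spelled
    out in coordinates, in which joint measurability is visible. *)
Let v_err n (x : n.-tuple T) (th : 'cV[R]_k) : R :=
  Num.sqrt n%:R * v x th - (Num.sqrt n%:R)^-1 * \sum_(i < n) p (tnth x i)
  - \sum_(j < k) c 0 j * (Num.sqrt n%:R * (th - th0) j 0).

Let mg_sum j n : measurable_fun setT (@g_sum j n).
Proof.
apply: measurable_funM => //.
exact: (measurable_sample_sum (g := fun x => g x j 0)).
Qed.

Let mt_sub j n : measurable_fun setT (fun x : n.-tuple T => (t x - th0) j 0).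
Proof.
under eq_fun do rewrite !mxE.
exact: (measurable_funB (@mt n j) (measurable_cst (th0 j 0))).
Qed.

Let mt_err j n : measurable_fun setT (@t_err j n).
Proof.
apply: measurable_funB; last exact: mg_sum.
by apply: measurable_funM => //; exact: mt_sub.
Qed.

Let mv_err n : jointly_measurable setT (@v_err n).
Proof.
apply: measurable_funB; first apply: measurable_funB.
- by apply: measurable_funM => //; exact: mv.
- apply: measurable_funM => //.
  exact: (measurableT_comp (measurable_sample_sum mp) measurable_fst).
- apply: measurable_sum => j; apply: measurable_funM => //; apply: measurable_funM => //.
  rewrite (_ : (fun z => _) = fun z => tnth z.2 j - th0 j 0); last first.
    by apply/funext => z; rewrite !mxE.
  apply: measurable_funB => //.
  exact: (measurableT_comp (measurable_tnth j) measurable_snd).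
Qed.

Let t_OP j : OP Pr (fun n w => Num.sqrt n%:R * (t (sample X 0 n w) - th0) j 0).
Proof.
have := OPD (oP_OP (t_lin j)) (iid_sum_OP X_iid (g_L20 j)).
by under eq_fun do under eq_fun do rewrite subrK.
Qed.

Let v_err_plug_in a l' b m : l' @ \oo --> \oo -> m @ \oo --> \oo ->
  (\forall n \near \oo, (a n + l' n <= b n)%N || (b n + m n <= a n)%N) ->
  (\forall n \near \oo, [/\ (0 < m n)%N & (l' n)%:R <= 4 * (m n)%:R :> R]) ->
  oP Pr (fun n w => v_err (sample X (a n) (l' n) w) (t (sample X (b n) (m n) w))).
Proof.
move=> linf minf disj lm.
apply: (oP_plug_in X_iid Theta_open Theta_th0) => //.
  move=> th loc; have := v_lin loc; congr (oP Pr); apply/funext => n; apply/funext => w.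
  rewrite /v_err sampleE; congr (_ - _).
  by rewrite mxE; apply: eq_bigr => j _; rewrite !mxE.
move=> j; have := OP_block (phi := fun n x => Num.sqrt n%:R * (t x - th0) j 0) X_iid
  _ b minf (t_OP j).
(* The estimator is tight at the root of its own block size [m n] but is needed at that of [l' n];
   the ratio of roots is at most 2 as [l' n] is at most four times [m n]. *)
move=> tb; apply: (OP_ext _ _ (OP_scale (K := 2)
  (a := fun n => Num.sqrt (l' n)%:R / Num.sqrt (m n)%:R) _ (tb _))).
- move=> n; apply: measurable_funM => //.
  exact: (measurableT_comp (@mt_sub j (m n)) (@mS _ _)).
- apply: filterS lm => n [m0 _] w; rewrite mulrA divfK//.
  by rewrite sqrtr_eq0 -ltNge ltr0n.
- apply: filterS lm => n [m0 lm]; rewrite ger0_norm ?divr_ge0 ?sqrtr_ge0//.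
  rewrite ler_pdivrMr ?sqrtr_gt0 ?ltr0n//.
  rewrite -ler_sqr ?nnegrE ?mulr_ge0 ?sqrtr_ge0// exprMn !sqr_sqrtr ?ler0n//.
  by rewrite -natrX.
- by move=> n; apply: measurable_funM => //; exact: mt_sub.
Qed.

Lemma split_linear : oP Pr (fun n w =>
  Num.sqrt n%:R *
    ((l n)%:R / n%:R * v (sample X 0 (l n) w) (t (sample X (l n) (n - l n) w))
     + (n - l n)%:R / n%:R * v (sample X (l n) (n - l n) w) (t (sample X 0 (l n) w)))
  - (Num.sqrt n%:R)^-1 * (\sum_(i < n) p (X i w))
  - \sum_(j < k) c 0 j * ((Num.sqrt n%:R)^-1 * \sum_(i < n) g (X i w) j 0)).
Proof.
have [linf minf] := half_split_infty l_half.
have quarter := half_split_quarter l_half.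
pose m n := (n - l n)%N.
pose S1 n w := sample X 0 (l n) w; pose S2 n w := sample X (l n) (m n) w.
pose s n : R := Num.sqrt (l n)%:R; pose q n : R := Num.sqrt (m n)%:R.
pose r n : R := Num.sqrt n%:R.
have sE n : s n ^+ 2 = (l n)%:R by rewrite sqr_sqrtr ?ler0n.
have qE n : q n ^+ 2 = (m n)%:R by rewrite sqr_sqrtr ?ler0n.
have rE n : r n ^+ 2 = n%:R by rewrite sqr_sqrtr ?ler0n.
have s_ge0 n : 0 <= s n by exact: sqrtr_ge0.
have q_ge0 n : 0 <= q n by exact: sqrtr_ge0.
have r_ge0 n : 0 <= r n by exact: sqrtr_ge0.
have roots : \forall n \near \oo, [/\ 0 < s n, 0 < q n & 0 < r n] /\
    [/\ s n <= r n, q n <= r n, r n <= 2 * s n & r n <= 2 * q n].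
  apply: filterS quarter => n [n0 ln nl nm].
  have N0 : 0 < n%:R :> R by rewrite ltr0n.
  split; split.
  - by rewrite sqrtr_gt0; lra.
  - by rewrite sqrtr_gt0; rewrite -/(m n) in nm; lra.
  - by rewrite sqrtr_gt0.
  - by rewrite ler_wsqrtr// ler_nat.
  - by rewrite ler_wsqrtr// ler_nat leq_subr.
  - rewrite -ler_sqr ?nnegrE ?mulr_ge0// exprMn rE sE -natrX; lra.
  - by rewrite -ler_sqr ?nnegrE ?mulr_ge0// exprMn rE qE -natrX.
have E1 : oP Pr (fun n w => s n / r n * v_err (S1 n w) (t (S2 n w))).
  apply: (oP_scale (K := 1)).
    apply: filterS roots => n [[s0 q0 r0] [sr _ _ _]].
    by rewrite ger0_norm ?divr_ge0// ler_pdivrMr// mul1r.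
  apply: (v_err_plug_in (a := fun=> 0%N)) => //.
    by apply: nearW => n; rewrite add0n leqnn.
  apply: filterS2 quarter roots => n [_ ln _ nm] [[_ q0 _] _]; split.
    by move: q0; rewrite sqrtr_gt0 ltr0n.
  by apply: le_trans nm; rewrite ler_nat.
have E2 : oP Pr (fun n w => q n / r n * v_err (S2 n w) (t (S1 n w))).
  apply: (oP_scale (K := 1)).
    apply: filterS roots => n [[s0 q0 r0] [_ qr _ _]].
    by rewrite ger0_norm ?divr_ge0// ler_pdivrMr// mul1r.
  apply: (v_err_plug_in (b := fun=> 0%N)) => //.
    by apply: nearW => n; rewrite add0n leqnn orbT.
  apply: filterS2 quarter roots => n [_ _ nl _] [[s0 _ _] _]; split.
    by move: s0; rewrite sqrtr_gt0 ltr0n.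
  by apply: le_trans nl; rewrite ler_nat leq_subr.
have t_err0 j : oP Pr (fun n w => t_err j (sample X 0 n w)).
  have := t_lin j; congr (oP Pr); apply/funext => n; apply/funext => w.
  by rewrite /t_err (sampleE (fun x => g x j 0)).
have g_sum0 j : OP Pr (fun n w => g_sum j (sample X 0 n w)).
  have := iid_sum_OP X_iid (g_L20 j); congr (OP Pr); apply/funext => n; apply/funext => w.
  by rewrite /g_sum (sampleE (fun x => g x j 0)).
(* The limiting ratio one half is used in full here: the difference of block sizes is at most
   [e / 2 * r n ^+ 2], and [r n <= 2 * y n] turns this into [e * (r n * y n)]. *)
have beta0 (y : nat -> R) : (forall n, 0 <= y n) ->
    (\forall n \near \oo, 0 < y n /\ r n <= 2 * y n) ->
    (fun n => (s n ^+ 2 - q n ^+ 2) / (r n * y n)) @ \oo --> (0 : R).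
  move=> y_ge0 yr; apply/cvgrPdist_le => e e0; near=> n.
  have [_ _ ln] : [/\ (0 < n)%N, (l n <= n)%N &
      `|(l n)%:R - (n - l n)%:R| <= e / 2 * n%:R :> R].
    by near: n; apply: half_split_dist => //; rewrite divr_gt0.
  have [[_ _ r0] _] : [/\ 0 < s n, 0 < q n & 0 < r n] /\
    [/\ s n <= r n, q n <= r n, r n <= 2 * s n & r n <= 2 * q n] by near: n.
  have [y0 ry] : 0 < y n /\ r n <= 2 * y n by near: n.
  rewrite sub0r normrN normrM normfV [X in _ / X]ger0_norm ?mulr_ge0//.
  rewrite ler_pdivrMr ?mulr_gt0// sE qE; apply: (le_trans ln).
  have h : r n * r n <= r n * (2 * y n) by rewrite ler_pM2l.
  rewrite -(rE n) expr2; apply: (le_trans (ler_wpM2l _ h)); first lra.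
  by rewrite (_ : _ / 2 * _ = e * (r n * y n))//; field.
pose rem j n w := c 0 j * (s n ^+ 2 / (r n * q n) * t_err j (S2 n w)
      + (s n ^+ 2 - q n ^+ 2) / (r n * q n) * g_sum j (S2 n w)
      + q n ^+ 2 / (r n * s n) * t_err j (S1 n w)
      + (q n ^+ 2 - s n ^+ 2) / (r n * s n) * g_sum j (S1 n w)).
have rem_oP j : oP Pr (rem j).
  apply: (oP_scale (K := `|c 0 j|)); first exact: nearW.
  apply: oPD; first apply: oPD; first apply: oPD.
  (* The bound 2 comes from [s n <= r n] and [s n <= r n <= 2 * q n]. *)
  - apply: (oP_scale (K := 2)); last exact: (oP_block X_iid (mt_err j) l minf).
    apply: filterS roots => n [[s0 q0 r0] [sr _ _ rq]].
    rewrite ger0_norm ?divr_ge0 ?mulr_ge0 ?sqr_ge0// ler_pdivrMr ?mulr_gt0//.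
    by rewrite mulrCA expr2; apply: ler_pM => //; exact: le_trans rq.
  - apply: OP_oP_scale; last exact: (OP_block X_iid (mg_sum j) l minf).
    by apply: beta0 => //; apply: filterS roots => n [[_ ? _] [_ _ _ ?]].
  - apply: (oP_scale (K := 2)); last exact: (oP_block X_iid (mt_err j) (fun=> 0%N) linf).
    apply: filterS roots => n [[s0 q0 r0] [_ qr rs _]].
    rewrite ger0_norm ?divr_ge0 ?mulr_ge0 ?sqr_ge0// ler_pdivrMr ?mulr_gt0//.
    by rewrite mulrCA expr2; apply: ler_pM => //; exact: le_trans rs.
  - apply: OP_oP_scale; last exact: (OP_block X_iid (mg_sum j) (fun=> 0%N) linf).
    under eq_fun do rewrite -opprB mulNr.
    rewrite -oppr0; apply: cvgN.
    by apply: beta0 => //; apply: filterS roots => n [[? _ _] [_ _ ? _]].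
have mX : forall i, measurable_fun setT (X i) by case: X_iid.
have mvt a' n1 b' n2 : measurable_fun setT
    (fun w => v (sample X a' n1 w) (t (sample X b' n2 w))).
  apply: (jointly_measurable_comp openT (@mv n1) (@mS _ _)) => // j.
  exact: (measurableT_comp (@mt n2 j) (@mS _ _)).
apply: oP_ext (oPD (oPD E1 E2) (oP_sum rem_oP)).
- move=> n; apply: measurable_funB; first apply: measurable_funB.
  + apply: measurable_funM => //; apply: measurable_funD; exact: measurable_funM.
  + apply: measurable_funM => //; apply: measurable_sum => i.
    exact: (measurableT_comp mp).
  + apply: measurable_sum => j; apply: measurable_funM => //.
    apply: measurable_funM => //; apply: measurable_sum => i.
    exact: (measurableT_comp (mg j)).
- apply: filterS2 quarter roots => n [_ ln _ _] [[s0 q0 r0] _] w.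
  have := split_identity (c 0) (fun j => (t (S1 n w) - th0) j 0)
    (fun j => (t (S2 n w) - th0) j 0)
    (fun j => \sum_(i < l n) g (tnth (S1 n w) i) j 0)
    (fun j => \sum_(i < m n) g (tnth (S2 n w) i) j 0)
    (v (S1 n w) (t (S2 n w))) (v (S2 n w) (t (S1 n w)))
    (\sum_(i < l n) p (tnth (S1 n w) i)) (\sum_(i < m n) p (tnth (S2 n w) i))
    (lt0r_neq0 s0) (lt0r_neq0 q0) (lt0r_neq0 r0).
  move=> id; rewrite -[RHS]id; congr (_ * _ - _ * _ - _).
  + by rewrite sE rE qE.
  + by rewrite (sum_nat_split (fun i => p (X i w)) ln) !sampleE.
  + apply: eq_bigr => j _; congr (_ * (_ * _)).
    by rewrite (sum_nat_split (fun i => g (X i w) j 0) ln) !(sampleE (fun x => g x j 0)).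
Unshelve. all: by end_near. Qed.

End split_linear.

(** * Coordinatewise form of (5) and assembly of the theorem *)

Lemma measurable_cV_norm {R : realType} {k : nat} {d : measure_display}
    {T : measurableType d} (v : T -> 'cV[R]_k) :
  (forall j, measurable_fun setT (fun x => v x j 0)) ->
  measurable_fun setT (fun x => `|v x|).
Proof.
move=> mv; under eq_fun do rewrite [`|v _|]mx_normrE.
elim: (index_enum _) => [|ij s IH].
  by under eq_fun do rewrite big_nil; exact: measurable_cst.
under eq_fun do rewrite big_cons.
apply: measurable_maxr => //; apply: measurableT_comp => //.
by case: ij => i j /=; rewrite (ord1 j); exact: mv.
Qed.

Lemma sqrt_natV {R : realType} (n : nat) :
  Num.sqrt n%:R * n%:R^-1 = (Num.sqrt n%:R)^-1 :> R.
Proof.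
(* For an empty sample both sides vanish because the inverse of 0 is 0. *)
have [->|n0] := eqVneq n 0%N; first by rewrite sqrtr0 mul0r invr0.
rewrite -[X in _ * X^-1]sqr_sqrtr ?ler0n// expr2 invfM mulrA divff ?mul1r//.
by rewrite sqrtr_eq0 -ltNge ltr0n lt0n.
Qed.

Section asymptotic_linearity.
Context {R : realType} {k : nat} {dO d : measure_display}.
Context {Om : measurableType dO} {T : measurableType d}.
Variables (Pr : probability Om R) (Q : probability T R) (X : nat -> Om -> T).
Hypothesis X_iid : iid Pr Q X.
Variables (t : forall n, n.-tuple T -> 'cV[R]_k) (th : nat -> 'cV[R]_k).
Variable a : nat -> T -> 'cV[R]_k.
Hypothesis mt : forall n j, measurable_fun setT (fun x : n.-tuple T => t x j 0).
Hypothesis ma : forall n j, measurable_fun setT (fun x => a n x j 0).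

Lemma asymptotically_linear_coord :
  cvg_in_probability Pr (fun n w => Num.sqrt n%:R *
    `|t (sample X 0 n w) - th n - n%:R^-1 *: \sum_(i < n) a n (X i w)|) ->
  forall j, oP Pr (fun n w => Num.sqrt n%:R * (t (sample X 0 n w) - th n) j 0
    - (Num.sqrt n%:R)^-1 * \sum_(i < n) a n (X i w) j 0).
Proof.
move=> t_lin j.
have mX : forall i, measurable_fun setT (X i) by case: X_iid.
have mtS n i : measurable_fun setT (fun w => t (sample X 0 n w) i 0).
  exact: (measurableT_comp (@mt n i) (@measurable_sample _ _ _ _ _ _ _ _ X_iid 0 n)).
have maS n i : measurable_fun setT (fun w => \sum_(m < n) a n (X m w) i 0).
  by apply: measurable_sum => m; exact: (measurableT_comp (ma n i)).
have VE n w i : (t (sample X 0 n w) - th n - n%:R^-1 *: \sum_(m < n) a n (X m w)) i 0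
    = t (sample X 0 n w) i 0 - th n i 0 - n%:R^-1 * \sum_(m < n) a n (X m w) i 0.
  by rewrite !mxE summxE.
have coordE n w : Num.sqrt n%:R * (t (sample X 0 n w) - th n) j 0
    - (Num.sqrt n%:R)^-1 * \sum_(i < n) a n (X i w) j 0 =
    Num.sqrt n%:R *
      (t (sample X 0 n w) - th n - n%:R^-1 *: \sum_(i < n) a n (X i w)) j 0.
  by rewrite VE -sqrt_natV !mxE [in RHS]mulrBr mulrA.
have mV n i : measurable_fun setT (fun w =>
    (t (sample X 0 n w) - th n - n%:R^-1 *: \sum_(m < n) a n (X m w)) i 0).
  under eq_fun do rewrite VE; apply: measurable_funB; last exact: measurable_funM.
  exact: measurable_funB.
have /oP_cvg t_oP : forall n, measurable_fun setT (fun w => Num.sqrt n%:R *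
    `|t (sample X 0 n w) - th n - n%:R^-1 *: \sum_(i < n) a n (X i w)|).
  by move=> n; apply: measurable_funM => //; exact: measurable_cV_norm.
apply: oP_le ((t_oP Pr).1 t_lin).
- by move=> n; under eq_fun do rewrite coordE; exact: measurable_funM.
- apply: nearW => n w; rewrite coordE !normrM normr_id.
  by rewrite ler_wpM2l// mx_coord_le.
Qed.

End asymptotic_linearity.

Theorem theorem5p1
  (R : realType) (k : nat)
  (d : measure_display) (T : measurableType d)
  (H : completeNormedModType R) (dot : H -> H -> R)
  (B : completeNormedModType R)
  (Theta : set 'cV[R]_k) (calG : set H)
  (P : 'cV[R]_k -> H -> probability T R)
  (nu : probability T R -> B) (nut : H -> B)
  (th0 : 'cV[R]_k) (G : H) (B0 : set (B -> R))
  (C : set (R -> H))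
  (l1 : 'cV[R]_k -> T -> 'cV[R]_k)
  (l2 : 'cV[R]_k -> H -> T -> R)
  (ls : 'cV[R]_k -> T -> 'cV[R]_k)
  (nudot : H -> B)
  (psi : H -> 'cV[R]_k -> T -> R)
  (dO : measure_display) (Om : measurableType dO) (Pr : probability Om R)
  (X : nat -> Om -> T)
  (t : forall n, n.-tuple T -> 'cV[R]_k)
  (u : forall n, n.-tuple T -> 'cV[R]_k -> B)
  (lam : nat -> nat)
  (* model *)
  (dot_inner : is_inner_product dot)
  (Theta_open : open Theta)
  (nuE : forall th g, Theta th -> calG g -> nu (P th g) = nut g)
  (Theta_th0 : Theta th0) (calG_G : calG G)
  (B0_dual : B0 `<=` dual_space B)
  (C_paths : C `<=` is_path calG G)
  (X_iid : iid Pr (P th0 G) X)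
  (* (1) *)
  (regular : regular_model Theta (fun th => P th G) l1)
  (hellinger : forall th, Theta th ->
     hellinger_derivative Theta P C th G (total_score (l1 th) (l2 th)))
  (tangents_closed : tangent_space C = tangents0 C)
  (nut_diff : pathwise_derivative C G nut nudot)
  (ls_eff : forall th, Theta th ->
     is_efficient_score (P th G) C (l1 th) (l2 th) (ls th))
  (info_unit : forall th, Theta th ->
     second_moment (P th G) (ls th) \in unitmx)
  (* (2) *)
  (grad_range : forall b, dual_space B b -> forall th, Theta th ->
     info_range (P th G) dot C (l2 th) (gradient dot C nudot b))
  (* psi h is defined at th when h lies in the range of l2^T l2 at th *)
  (psi_def : forall h th, Theta th ->
     info_range (P th G) dot C (l2 th) h ->
     is_influence (P th G) dot C (l2 th) h (psi h th))
  (* jointly measurable versions and statistics *)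
  (l1_meas : forall i, jointly_measurable Theta (fun x th => l1 th x i 0))
  (l2_meas : forall g, tangent_space C g ->
     jointly_measurable Theta (fun x th => l2 th g x))
  (ls_meas : forall i, jointly_measurable Theta (fun x th => ls th x i 0))
  (psi_meas : forall h,
     (forall th, Theta th -> info_range (P th G) dot C (l2 th) h) ->
     jointly_measurable Theta (fun x th => psi h th x))
  (t_meas : forall n i, measurable_fun setT (fun x : n.-tuple T => t n x i 0))
  (u_meas : forall n b, B0 b ->
     jointly_measurable setT (fun (x : n.-tuple T) th => b (u n x th)))
  (* (3) *)
  (psi_smooth : forall h,
     (forall th, Theta th -> info_range (P th G) dot C (l2 th) h) ->
     forall th : nat -> 'cV[R]_k, root_n_local Theta th0 th ->
     let c := fun th' => score_correlation (P th' G) (psi h th') (l1 th') in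
     cvg_in_probability Pr (fun n w =>
       (Num.sqrt n%:R)^-1 * (\sum_(i < n) psi h (th n) (X i w))
       - (Num.sqrt n%:R)^-1 * (\sum_(i < n) psi h th0 (X i w))
       - (c th0 *m (Num.sqrt n%:R *: (th n - th0))) 0 0) /\
     c (th n) @[n --> \oo] --> c th0)
  (* (4) *)
  (u_eff : forall th : nat -> 'cV[R]_k, root_n_local Theta th0 th ->
     forall b, B0 b ->
     cvg_in_probability Pr (fun n w =>
       Num.sqrt n%:R *
       `|b (u n (sample X 0 n w) (th n) - nut G)
         - n%:R^-1 *
           \sum_(i < n) psi (gradient dot C nudot b) (th n) (X i w)|))
  (* (5) *)
  (t_eff : forall th : nat -> 'cV[R]_k, root_n_local Theta th0 th ->
     cvg_in_probability Pr (fun n w =>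
       Num.sqrt n%:R *
       `|t n (sample X 0 n w) - th n
         - n%:R^-1 *: \sum_(i < n)
             (invmx (second_moment (P (th n) G) (ls (th n)))
              *m ls (th n) (X i w))|))
  (lam_half : ((lam n)%:R / n%:R : R) @[n --> \oo] --> (2^-1 : R)) :
  forall th : nat -> 'cV[R]_k, root_n_local Theta th0 th ->
  forall b, B0 b ->
  let psib := psi (gradient dot C nudot b) in
  cvg_in_probability Pr (fun n w =>
    Num.sqrt n%:R *
    `|b (split_estimator X t u lam n w - nu (P (th n) G))
      - n%:R^-1 * \sum_(i < n)
          (psib (th n) (X i w)
           + (score_correlation (P (th n) G) (psib (th n)) (l1 (th n))
              *m (invmx (second_moment (P (th n) G) (ls (th n)))
                  *m ls (th n) (X i w))) 0 0)|).

Proof.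
move=> th th_loc b Bb psib.
have [b_lin _] := B0_dual _ Bb.
have b0 : b 0 = 0 by have := b_lin (- 1) 0 0; rewrite scaler0 addr0 mulN1r addNr.
have bD x y : b (x + y) = b x + b y by have := b_lin 1 x y; rewrite scale1r mul1r.
have bZ a x : b (a *: x) = a * b x by have := b_lin a x 0; rewrite !addr0 b0 addr0.
have bB x y : b (x - y) = b x - b y by rewrite bD -scaleN1r bZ mulN1r.
have h_range th' : Theta th' ->
    info_range (P th' G) dot C (l2 th') (gradient dot C nudot b).
  by move=> Tth; apply: grad_range => //; exact: B0_dual.
have mpsi th' : Theta th' -> measurable_fun setT (psib th').
  exact: (jointly_measurable_section Theta_open (psi_meas _ h_range)).
have loc0 : root_n_local Theta th0 (fun=> th0).
  by split=> //; exists 0 => n; rewrite subrr scaler0 normr0.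
have mX : forall i, measurable_fun setT (X i) by case: X_iid.
have mS a n : measurable_fun setT (sample X a n) by exact: (measurable_sample X_iid).
pose J th' := invmx (second_moment (P th' G) (ls th')).
pose inf th' x := J th' *m ls th' x.
pose c th' := score_correlation (P th' G) (psib th') (l1 th').
have minf th' j : Theta th' -> measurable_fun setT (fun x => inf th' x j 0).
  move=> Tth; under eq_fun do rewrite mxE.
  apply: measurable_sum => i; apply: measurable_funM => //.
  by have [] := ls_eff _ Tth i.
have inf_L20 j : L20 (P th0 G) (fun x => inf th0 x j 0).
  under eq_fun do rewrite mxE; apply: L20_sum => i.
  exact: (efficient_score_L20 (hellinger _ Theta_th0) (ls_eff _ Theta_th0)).
have t_lin (ths : nat -> 'cV[R]_k) : root_n_local Theta th0 ths -> forall j, oP Pr (fun n w =>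
    Num.sqrt n%:R * (t n (sample X 0 n w) - ths n) j 0
    - (Num.sqrt n%:R)^-1 * \sum_(i < n) inf (ths n) (X i w) j 0).
  move=> loc; apply: (asymptotically_linear_coord X_iid (a := fun n => inf (ths n))) => //.
  - by move=> n j; apply: minf; exact: loc.1.
  - exact: t_eff.
have mpsiS th' n : Theta th' -> measurable_fun setT (fun w => \sum_(i < n) psib th' (X i w)).
  by move=> Tth; apply: measurable_sum => i; exact: (measurableT_comp (mpsi _ Tth)).
have psi_oP (ths : nat -> 'cV[R]_k) : root_n_local Theta th0 ths -> oP Pr (fun n w =>
    (Num.sqrt n%:R)^-1 * (\sum_(i < n) psib (ths n) (X i w))
    - (Num.sqrt n%:R)^-1 * (\sum_(i < n) psib th0 (X i w))
    - (c th0 *m (Num.sqrt n%:R *: (ths n - th0))) 0 0).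
  move=> loc; apply/oP_cvg; last exact: (psi_smooth _ h_range _ loc).1.
  move=> n; apply: measurable_funB => //; apply: measurable_funB.
  - by apply: measurable_funM => //; apply: mpsiS; exact: loc.1.
  - by apply: measurable_funM => //; exact: mpsiS.
pose v n (x : n.-tuple T) th' := b (u n x th') - b (nut G).
have mv n : jointly_measurable setT (v n).
  by apply: measurable_funB => //; exact: u_meas.
have mvS n th' : measurable_fun setT (fun w => v n (sample X 0 n w) th').
  exact: (measurableT_comp (jointly_measurable_section openT (mv n) I) (@mS 0%N n)).
have v_lin (ths : nat -> 'cV[R]_k) : root_n_local Theta th0 ths -> oP Pr (fun n w =>
    Num.sqrt n%:R * v n (sample X 0 n w) (ths n)
    - (Num.sqrt n%:R)^-1 * (\sum_(i < n) psib th0 (X i w))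
    - (c th0 *m (Num.sqrt n%:R *: (ths n - th0))) 0 0).
  (* Here [A] is the remainder in (4), with influence function taken at [ths n]; adding the
     remainder in (3) moves that function to [th0] at the cost of the drift term. *)
  move=> loc; pose A n w := v n (sample X 0 n w) (ths n)
    - n%:R^-1 * \sum_(i < n) psib (ths n) (X i w).
  have mA n : measurable_fun setT (A n).
    apply: measurable_funB => //; apply: measurable_funM => //.
    by apply: mpsiS; exact: loc.1.
  have A_oP : oP Pr (fun n w => Num.sqrt n%:R * A n w).
    apply: (@oP_le _ _ _ _ _ (fun n w => Num.sqrt n%:R * `|A n w|)).
    - by move=> n; exact: measurable_funM.
    - by apply: nearW => n w; rewrite !normrM normr_id.
    apply/oP_cvg.
      by move=> n; apply: measurable_funM => //; exact: measurableT_comp.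
    have := u_eff _ loc _ Bb; congr (cvg_in_probability Pr).
    by apply/funext => n; apply/funext => w; rewrite bB.
  have := oPD A_oP (psi_oP _ loc); congr (oP Pr).
  apply/funext => n; apply/funext => w.
  by rewrite /A mulrBr [_ * (_^-1 * _)]mulrA sqrt_natV; ring.
have lin := split_linear X_iid Theta_open Theta_th0 t_meas inf_L20 (t_lin _ loc0)
  mv (mpsi _ Theta_th0) v_lin lam_half.
pose D (ths : nat -> 'cV[R]_k) j n w := Num.sqrt n%:R * (t n (sample X 0 n w) - ths n) j 0
    - (Num.sqrt n%:R)^-1 * \sum_(i < n) inf (ths n) (X i w) j 0.
pose K j n w := (Num.sqrt n%:R)^-1 * \sum_(i < n) inf (th n) (X i w) j 0.
have [th_T [M thM]] := th_loc.
(* The summands of [K] vary with [n] and need not be centred under the law at [th0], so the variance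
   bound does not apply directly. Subtracting (5) along [th] from (5) at [th0] eliminates the
   estimator and expresses [K] through the sum at [th0], a bounded drift and negligible terms. *)
have K_OP j : OP Pr (K j).
  have shift : OP Pr (fun n _ => - (Num.sqrt n%:R * (th n - th0) j 0)).
    apply: (@OP_cst _ _ _ _ _ M); apply: nearW => n; rewrite normrN; apply: le_trans (thM n).
    by have := mx_coord_le (Num.sqrt n%:R *: (th n - th0)) j 0; rewrite mxE.
  have D_OP : OP Pr (fun n w => - 1 * D th j n w).
    apply: (OP_scale (K := 1)); last exact/oP_OP/t_lin.
    by apply: nearW => n; rewrite normrN normr1.
  have := OPD (OPD D_OP (oP_OP (t_lin _ loc0 j)))
              (OPD (iid_sum_OP X_iid (inf_L20 j)) shift).
  congr (OP Pr); apply/funext => n; apply/funext => w.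
  by rewrite /D /K !mxE; ring.
have c_cvg j : (fun n => c th0 0 j - c (th n) 0 j) @ \oo --> (0 : R).
  have /cvgrPdist_le c_lim := (psi_smooth _ h_range _ th_loc).2.
  apply/cvgrPdist_le => e /c_lim; apply: filterS => n; apply: le_trans.
  rewrite sub0r normrN.
  by have := mx_coord_le (c th0 - c (th n)) 0 j; rewrite [X in `|X| <= _]mxE [X in _ + X]mxE.
pose W1 n w := Num.sqrt n%:R *
    ((lam n)%:R / n%:R *
       v (lam n) (sample X 0 (lam n) w) (t (n - lam n)%N (sample X (lam n) (n - lam n) w))
     + (n - lam n)%:R / n%:R *
       v (n - lam n)%N (sample X (lam n) (n - lam n) w) (t (lam n) (sample X 0 (lam n) w)))
  - (Num.sqrt n%:R)^-1 * (\sum_(i < n) psib th0 (X i w))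
  - \sum_(j < k) c th0 0 j * ((Num.sqrt n%:R)^-1 * \sum_(i < n) inf th0 (X i w) j 0).
pose W2 n w := (Num.sqrt n%:R)^-1 * (\sum_(i < n) psib (th n) (X i w))
    - (Num.sqrt n%:R)^-1 * (\sum_(i < n) psib th0 (X i w))
    - (c th0 *m (Num.sqrt n%:R *: (th n - th0))) 0 0.
(* The difference of the two [D] terms replaces the sum of [inf] at [th0] by [K] and produces the
   drift that cancels the one in [W2]. The last summand exchanges [c th0] for [c (th n)], a
   vanishing factor times the tight [K]. *)
pose W3 j n w := c th0 0 j * (D th j n w + - 1 * D (fun=> th0) j n w)
  + (c th0 0 j - c (th n) 0 j) * K j n w.
have W_oP : oP Pr (fun n w => W1 n w + - 1 * W2 n w + \sum_(j < k) W3 j n w).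
  have N1 : \forall n \near \oo, `|- 1 : R| <= 1.
    by apply: nearW => n; rewrite normrN normr1.
  apply: oPD; first by apply: oPD => //; apply: oP_scale N1 _; exact: psi_oP.
  apply: oP_sum => j; apply: oPD; last exact: OP_oP_scale.
  apply: (oP_scale (K := `|c th0 0 j|)); first exact: nearW.
  by apply: oPD; [|apply: oP_scale N1 _]; exact: t_lin.
pose Y n w := b (split_estimator X t u lam n w - nu (P (th n) G))
  - n%:R^-1 * \sum_(i < n) (psib (th n) (X i w) + (c (th n) *m inf (th n) (X i w)) 0 0).
have mbu a n1 b' n2 : measurable_fun setT
    (fun w => b (u n1 (sample X a n1 w) (t n2 (sample X b' n2 w)))).
  apply: (jointly_measurable_comp openT (u_meas n1 b Bb) (@mS _ _)) => // j.
  exact: (measurableT_comp (t_meas n2 j) (@mS _ _)).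
have mY n : measurable_fun setT (Y n).
  apply: measurable_funB.
    under eq_fun do rewrite bB bD !bZ.
    apply: measurable_funB => //; apply: measurable_funD; exact: measurable_funM.
  apply: measurable_funM => //; apply: measurable_sum => i; apply: measurable_funD.
    exact: (measurableT_comp (mpsi _ (th_T n))).
  under eq_fun do rewrite mxE; apply: measurable_sum => j; apply: measurable_funM => //.
  exact: (measurableT_comp (minf _ j (th_T n))).
have YW : \forall n \near \oo, forall w,
    Num.sqrt n%:R * Y n w = W1 n w + - 1 * W2 n w + \sum_(j < k) W3 j n w.
  apply: filterS (half_split_quarter lam_half) => n [n0 ln _ _] w.
  have N0 : n%:R != 0 :> R by rewrite pnatr_eq0 -lt0n.
  (* The two weights add up to one, so the centring [b (nut G)] can be shared between the halves;
     this needs [n] nonzero and [lam n <= n], hence holds only eventually. *)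
  have bsplit : b (split_estimator X t u lam n w - nu (P (th n) G)) =
      (lam n)%:R / n%:R *
       v (lam n) (sample X 0 (lam n) w) (t (n - lam n)%N (sample X (lam n) (n - lam n) w))
     + (n - lam n)%:R / n%:R *
       v (n - lam n)%N (sample X (lam n) (n - lam n) w) (t (lam n) (sample X 0 (lam n) w)).
    by rewrite bB bD !bZ (nuE _ _ (th_T n) calG_G) /v natrB//; field.
  have infE : \sum_(i < n) (psib (th n) (X i w) + (c (th n) *m inf (th n) (X i w)) 0 0) =
      \sum_(i < n) psib (th n) (X i w)
      + \sum_(j < k) c (th n) 0 j * \sum_(i < n) inf (th n) (X i w) j 0.
    rewrite big_split; congr (_ + _); under eq_bigr do rewrite mxE.
    by rewrite exchange_big; apply: eq_bigr => j _; rewrite mulr_sumr.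
  have W3E : \sum_(j < k) W3 j n w =
      \sum_(j < k) c th0 0 j * ((Num.sqrt n%:R)^-1 * \sum_(i < n) inf th0 (X i w) j 0)
      - (c th0 *m (Num.sqrt n%:R *: (th n - th0))) 0 0
      - (Num.sqrt n%:R)^-1 *
        \sum_(j < k) c (th n) 0 j * \sum_(i < n) inf (th n) (X i w) j 0.
    rewrite [X in _ - X - _]mxE mulr_sumr -!sumrB; apply: eq_bigr => j _.
    by rewrite /W3 /D /K !mxE; ring.
  by rewrite /Y bsplit infE W3E /W1 /W2 mulrBr [_ * (_^-1 * _)]mulrA sqrt_natV; ring.
have mYn n : measurable_fun setT (fun w => Num.sqrt n%:R * `|Y n w|).
  by apply: measurable_funM => //; exact: measurableT_comp.
apply/oP_cvg; [exact: mYn|apply: oP_le mYn _ W_oP].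
by apply: filterS YW => n YWn w; rewrite -YWn !normrM normr_id.
Qed.
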